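(* Let $w\in S_n$ be a permutation avoiding the pattern $1423$. Then the reduction map $\Phi:\mathrm{MRPD}(w)\to\bigsqcup_{v\le w}\mathrm{CMRPD}(v)$ is a bijection.
   Context: Let $v=v_1\cdots v_m$ be a word of distinct positive integers with sorted entries $a_1<\dots<a_m$. A pipe dream for $v$ fills the staircase $\{(i,k):i+k\le m+1\}$ (row $i$ from top, column $k$ from left) with crossing tiles and bumping tiles (upper-left arc joining top and left edges, lower-right arc joining bottom and right edges), tiles $(i,m+1-i)$ being bumping. Pipe $a_k$ enters at the top of column $k$, travels down/left to the left boundary. Reduced: any two pipes cross at most once and the pipe exiting row $i$ is labelled $v_i$. A marked reduced pipe dream additionally marks some bumping tiles, a bumping tile in row $i$ being markable only if its two pipes cross at a crossing in a row strictly above $i$; $\mathrm{MRPD}(v)$ is the set of these. Pipe $j$ (entering column $C_j$) is removable if (i) column $C_j$ consists of crossings all traversed by pipe $j$ followed only by unmarked bumping tiles; (ii) for each crossing traversed by pipe $j$ the tile directly above (if any) is not an unmarked bumping tile; (iii) pipe $j$ traverses no marked bumping tile. $P$ is core if no pipe is removable; $\mathrm{CMRPD}(v)$ is the set of core elements of $\mathrm{MRPD}(v)$. For removable $j$, in each column $c<C_j$ pipe $j$ traverses either one crossing horizontally or two vertically adjacent unmarked bumping tiles $(r,c),(r+1,c)$ (entering $(r,c)$ from the right, leaving $(r+1,c)$ to the left); $\Phi_j(P)\in\mathrm{MRPD}(v\setminus j)$ deletes column $C_j$, deletes in each column $c<C_j$ that crossing (or the lower-right half of $(r,c)$ and the upper-left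 half of $(r+1,c)$), then shifts tiles right of $C_j$ one unit left and, in columns $c<C_j$, tiles/half-tiles below pipe $j$ one unit up (remaining halves forming one unmarked bumping tile), keeping other tiles and markings. If $P\in\mathrm{MRPD}(w)$ has removable pipes $j_1,\dots,j_k$, then $\Phi(P)=\Phi_{j_k}(\cdots\Phi_{j_1}(P)\cdots)$, which is independent of the order and lies in $\mathrm{CMRPD}(v)$, $v$ being $w$ with $j_1,\dots,j_k$ deleted. The union is over all subwords $v$ of $w$. *)

(* Defs.v *)
From HB Require Import structures.
From mathcomp Require Import all_boot.

Set Implicit Arguments.
Unset Strict Implicit.
Unset Printing Implicit Defensive.

(* Conventions: all rows/columns are 0-indexed.  A word v of length m has a
   pipe dream on the staircase {(r,c) | r + c < m}, stored row by row:
   row r is a list of m - r tiles (columns 0 .. m-1-r). *)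

Inductive tile := Cross | Bump (* unmarked bumping *) | MBump (* marked bumping *).

Definition tile_eqb (a b : tile) : bool :=
  match a, b with
  | Cross, Cross | Bump, Bump | MBump, MBump => true
  | _, _ => false
  end.
Lemma tile_eqP : Equality.axiom tile_eqb.
Proof. by case; case; constructor. Qed.
HB.instance Definition _ := hasDecEq.Build tile tile_eqP.

(* How a pipe passes through a tile: vertically / horizontally through a
   crossing, through the upper-left arc (top->left) or the lower-right arc
   (right->bottom) of a bumping tile. *)
Inductive kind := Vert | Horiz | UL | LR.
Definition kind_eqb (a b : kind) : bool :=
  match a, b with
  | Vert, Vert | Horiz, Horiz | UL, UL | LR, LR => true
  | _, _ => false
  end.
Lemma kind_eqP : Equality.axiom kind_eqb.
Proof. by case; case; constructor. Qed.
HB.instance Definition _ := hasDecEq.Build kind kind_eqP.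

Definition pdream := seq (seq tile).

Definition tile_at (P : pdream) (r c : nat) : tile := nth Cross (nth [::] P r) c.

Definition is_cross (t : tile) : bool := t == Cross.
Definition is_bumping (t : tile) : bool := t != Cross.

(* Trace a pipe; state (r, c, down) : the pipe enters tile (r,c) from the top
   (down = true) or from the right (down = false).  Returns the list of
   visited tiles with the way they are traversed and the row from which the
   pipe exits at the left boundary. *)
Fixpoint trace (P : pdream) (fuel r c : nat) (down : bool)
  : seq (nat * nat * kind) * nat :=
  match fuel with
  | 0 => ([::], 0)
  | fuel'.+1 =>
    let t := tile_at P r c in
    if down then
      if is_cross t then
        let: (vs, e) := trace P fuel' r.+1 c true in ((r, c, Vert) :: vs, e)
      else
        if c is c'.+1 then
          let: (vs, e) := trace P fuel' r c' false in ((r, c, UL) :: vs, e)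
        else ([:: (r, c, UL)], r)
    else
      if is_cross t then
        if c is c'.+1 then
          let: (vs, e) := trace P fuel' r c' false in ((r, c, Horiz) :: vs, e)
        else ([:: (r, c, Horiz)], r)
      else
        let: (vs, e) := trace P fuel' r.+1 c true in ((r, c, LR) :: vs, e)
  end.

(* the pipe entering at the top of column k (the measure (m - r) + c
   strictly decreases, so 2m+1 steps suffice) *)
Definition pipe_visits (P : pdream) (k : nat) : seq (nat * nat * kind) :=
  (trace P (2 * size P).+1 0 k true).1.
Definition pipe_exit (P : pdream) (k : nat) : nat :=
  (trace P (2 * size P).+1 0 k true).2.

Definition visits_cell (P : pdream) (k r c : nat) : bool :=
  has (fun x : nat * nat * kind => (x.1.1 == r) && (x.1.2 == c)) (pipe_visits P k).

(* pipe a_{k+1} (k-th smallest entry of v) enters column k *)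
Definition label (v : seq nat) (k : nat) : nat := nth 0 (sort leq v) k.
Definition col_of (v : seq nat) (j : nat) : nat := index j (sort leq v).

Definition ncross (P : pdream) (k l : nat) : nat :=
  count (fun x : nat * nat * kind =>
           ((x.2 == Vert) || (x.2 == Horiz)) && visits_cell P l x.1.1 x.1.2)
        (pipe_visits P k).

Definition well_shaped (m : nat) (P : pdream) : Prop :=
  size P = m /\ (forall r, r < m -> size (nth [::] P r) = m - r).

Definition reduced (v : seq nat) (P : pdream) : Prop :=
  let m := size v in
  (forall k, k < m -> nth 0 v (pipe_exit P k) = label v k) /\
  (forall k l, k < m -> l < m -> k != l -> ncross P k l <= 1).

Definition markable (m : nat) (P : pdream) (r c : nat) : Prop :=
  exists p q, [/\ p < m, q < m, (r, c, UL) \in pipe_visits P p,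
                  (r, c, LR) \in pipe_visits P q &
                  exists r' c', [/\ r' < r, r' + c' < m,
                                    is_cross (tile_at P r' c'),
                                    visits_cell P p r' c' & visits_cell P q r' c']].

Definition MRPD (v : seq nat) (P : pdream) : Prop :=
  let m := size v in
  [/\ well_shaped m P,
      (forall r c, r + c = m.-1 -> r < m -> is_bumping (tile_at P r c)),
      reduced v P &
      (forall r c, r + c < m -> tile_at P r c = MBump -> markable m P r c)].

Definition removable (v : seq nat) (P : pdream) (j : nat) : bool :=
  let m := size v in
  let C := col_of v j in
  [&& j \in v,
      has (fun t => all (fun r => if r < t
                                  then is_cross (tile_at P r C) && visits_cell P C r C
                                  else tile_at P r C == Bump)
                        (iota 0 (m - C)))
          (iota 0 (m - C).+1),
      all (fun x : nat * nat * kind =>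
             ((x.2 == Vert) || (x.2 == Horiz)) ==> (0 < x.1.1) ==>
             (tile_at P x.1.1.-1 x.1.2 != Bump))
          (pipe_visits P C) &
      all (fun x : nat * nat * kind => tile_at P x.1.1 x.1.2 != MBump)
          (pipe_visits P C)].

Definition CMRPD (v : seq nat) (P : pdream) : Prop :=
  MRPD v P /\ (forall j, ~~ removable v P j).

Definition colexit (P : pdream) (k c : nat) : option (nat * kind) :=
  omap (fun x : nat * nat * kind => (x.1.1, x.2))
       (ohead (rev [seq x <- pipe_visits P k | x.1.2 == c])).

Definition newtile (P : pdream) (C r c : nat) : tile :=
  if C <= c then tile_at P r c.+1 else
  match colexit P C c with
  | Some (e, Horiz) =>
      if r < e then tile_at P r c else tile_at P r.+1 c
  | Some (e, UL) => (* pipe uses LR of (e-1,c) and UL of (e,c): merge *)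
      if r.+1 < e then tile_at P r c
      else if r.+1 == e then Bump else tile_at P r.+1 c
  | _ => tile_at P r c
  end.

Definition PhiOne (v : seq nat) (P : pdream) (j : nat) : seq nat * pdream :=
  let C := col_of v j in
  let m' := (size v).-1 in
  (rem j v, mkseq (fun r => mkseq (fun c => newtile P C r c) (m' - r)) m').

Definition Phi (w : seq nat) (P : pdream) : seq nat * pdream :=
  foldl (fun acc j => PhiOne acc.1 acc.2 j) (w, P)
        [seq j <- w | removable w P j].

Definition avoids1423 (w : seq nat) : Prop :=
  forall i j k l, i < j -> j < k -> k < l -> l < size w ->
    ~ [/\ nth 0 w i < nth 0 w k, nth 0 w k < nth 0 w l & nth 0 w l < nth 0 w j].

(* Main.v *)
(* Reading a pipe dream column by column from right to left, the labels on the
   left edge of a column are obtained from those on its right edge by carrying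
   the top label down: a crossing lets the row label through, a bump exchanges
   it with the carried one.  A marked filling is a marked reduced pipe dream
   exactly when every crossing carries a label smaller than the row label and
   every marked bump a larger one.

   Removing a removable pipe deletes one tile from every column it traverses.
   This can be undone from the row in which the pipe exits: going to the right,
   if the tile above the insertion point is an unmarked bump it is doubled and
   the pipe climbs one row, otherwise a crossing is inserted.  Deletion does not
   affect the removability of other pipes, so everything reduces to one pipe.

   An inserted crossing of pipe [j] is illegal if some [b > j] is carried through
   it.  The tile above sends a label [d > b] to the left, just above [j], while
   the small top label of that column has left it above [d].  Every further
   column brings a small label from the top and can move only one label down
   across [d], so some [x < j] exits above [d], and [x], [d], [j], [b] form
   the pattern 1423. *)
From HB Require Import structures.
From mathcomp Require Import all_boot.
From mathcomp Require Import zify.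
Require Import Defs.

Set Implicit Arguments.
Unset Strict Implicit.
Unset Printing Implicit Defensive.

(** * Deleting and inserting an entry of a list *)

Section InsertDelete.
Variable X : Type.
Implicit Types (s : seq X) (x : X) (e i : nat).

Definition delat e s := take e s ++ drop e.+1 s.
Definition insat e x s := take e s ++ x :: drop e s.

Lemma size_delat e s : e < size s -> size (delat e s) = (size s).-1.
Proof. by move=> h; rewrite size_cat size_take size_drop h; lia. Qed.

Lemma size_insat e x s : size (insat e x s) = (size s).+1.
Proof. by rewrite size_cat /= addnS -size_cat cat_take_drop. Qed.

Lemma nth_delat x0 e s i :
  nth x0 (delat e s) i = nth x0 s (if i < e then i else i.+1).
Proof.
rewrite nth_cat size_take; case: (ltnP e (size s)) => he.
  case: ltnP => hi; first by rewrite nth_take.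
  by rewrite nth_drop; congr nth; lia.
rewrite drop_oversize ?nth_nil ?take_oversize; try lia.
case: ltnP => hi; first by rewrite ifT //; lia.
by rewrite nth_default //; case: ifP => _; lia.
Qed.

Lemma nth_insat x0 e x s i : e <= size s ->
  nth x0 (insat e x s) i =
  if i < e then nth x0 s i else if i == e then x else nth x0 s i.-1.
Proof.
move=> he; rewrite nth_cat size_takel //; case: ltnP => hi; first by rewrite nth_take.
case: eqP => [->|ne]; first by rewrite subnn.
have -> : i - e = (i.-1 - e).+1 by lia.
by rewrite /= nth_drop; congr nth; lia.
Qed.

Lemma insat_delat x0 e s : e < size s -> insat e (nth x0 s e) (delat e s) = s.
Proof.
move=> he; rewrite /insat /delat take_size_cat ?size_takel //; last exact: ltnW.
rewrite drop_size_cat ?size_takel //; last exact: ltnW.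
by rewrite -drop_nth // cat_take_drop.
Qed.

Lemma delat_insat e x s : e <= size s -> delat e (insat e x s) = s.
Proof.
move=> he; rewrite /delat /insat take_size_cat ?size_takel //.
rewrite -cat_rcons drop_size_cat ?cat_take_drop // size_rcons size_takel //.
Qed.

Lemma delatS e x s : delat e.+1 (x :: s) = x :: delat e s.
Proof. by []. Qed.

Lemma insatS e y x s : insat e.+1 y (x :: s) = x :: insat e y s.
Proof. by []. Qed.

End InsertDelete.

Arguments delat [X] e s : simpl never.
Arguments insat [X] e x s : simpl never.

Lemma rem_delat (T : eqType) (x : T) s : rem x s = delat (index x s) s.
Proof.
elim: s => //= y s IH; case: eqP => _; first by rewrite /delat /= drop0.
by rewrite delatS IH.
Qed.

Lemma index_insat (T : eqType) (x : T) e s : e <= size s -> x \notin s ->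
  index x (insat e x s) = e.
Proof.
move=> he hx; rewrite /insat index_cat ifF /= ?eqxx ?addn0 ?size_takel //.
by apply/negP => /mem_take h; rewrite h in hx.
Qed.

Lemma rem_insat (T : eqType) (x : T) e s : e <= size s -> x \notin s ->
  rem x (insat e x s) = s.
Proof. by move=> he hx; rewrite rem_delat index_insat // delat_insat. Qed.

Lemma insat_rem (T : eqType) (x : T) s : x \in s -> insat (index x s) x (rem x s) = s.
Proof.
move=> hx; rewrite rem_delat -{2}(nth_index x hx) insat_delat ?index_mem //.
Qed.

(** * Columns *)

(* The labels entering a column from the right are [ys] and
   the label entering from the top is [a]; [cstep] returns the labels leaving
   to the left.  The last tile, on the antidiagonal, has nothing on its right. *)
Fixpoint cstep (T : seq tile) (a : nat) (ys : seq nat) : seq nat :=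
  match T, ys with
  | t :: T', y :: ys' =>
      if t == Cross then y :: cstep T' a ys' else a :: cstep T' y ys'
  | _, _ => a :: ys
  end.

(** The label on the top edge of tile [r], that is, of the pipe entering this tile from above. *)
Fixpoint carry (T : seq tile) (a : nat) (ys : seq nat) (r : nat) : nat :=
  match r, T, ys with
  | r'.+1, t :: T', y :: ys' => carry T' (if t == Cross then a else y) ys' r'
  | _, _, _ => a
  end.

(* In a reduced pipe dream the vertical pipe of a crossing has the smaller
   label, and a bump may be marked when its upper-left pipe has the larger. *)
Definition tileok (t : tile) (a y : nat) : bool :=
  match t with Cross => a < y | Bump => true | MBump => y < a end.

(** No label comes from the right at the last tile, so it can only be an unmarked bump. This case
    also forces the column to have exactly one tile more than [ys] has labels. *)
Fixpoint okcol (T : seq tile) (a : nat) (ys : seq nat) : bool :=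
  match T, ys with
  | t :: T', y :: ys' => tileok t a y && okcol T' (if t == Cross then a else y) ys'
  | t :: T', [::] => (t == Bump) && nilp T'
  | [::], _ => false
  end.

Lemma size_cstep T a ys : size (cstep T a ys) = (size ys).+1.
Proof. by elim: T a ys => [|t T IH] a [|y ys] //=; case: ifP => _ /=; rewrite IH. Qed.

Lemma perm_swap (T : eqType) (x y : T) s : perm_eq (x :: y :: s) (y :: x :: s).
Proof. by rewrite -[x :: _]/([:: x] ++ [:: y] ++ s) perm_catCA. Qed.

Lemma perm_cstep T a ys : perm_eq (cstep T a ys) (a :: ys).
Proof.
elim: T a ys => [|t T IH] a [|y ys] //=; case: ifP => _; last by rewrite perm_cons.
by apply: perm_trans (perm_swap _ _ _); rewrite perm_cons.
Qed.

Lemma size_okcol T a ys : okcol T a ys -> size T = (size ys).+1.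
Proof.
elim: T a ys => [|t T IH] a [|y ys] //=; first by case: t; case: T {IH}.
by case/andP => _ /IH ->.
Qed.

Lemma okcol_last T a ys : okcol T a ys -> nth Cross T (size ys) = Bump.
Proof.
elim: T a ys => [|t T IH] a [|y ys] //=; first by case: t; case: T {IH}.
by case/andP => _ /IH.
Qed.

Lemma okcolP T a ys :
  reflect [/\ size T = (size ys).+1, nth Cross T (size ys) = Bump &
              forall r, r < size ys ->
                tileok (nth Cross T r) (carry T a ys r) (nth 0 ys r)]
          (okcol T a ys).
Proof.
apply: (iffP idP) => [h|].
  split; [exact: size_okcol h|exact: okcol_last h|].
  elim: T a ys h => [|t T IH] a [|y ys] //= /andP[h1 h2] [|r] //= hr.
  exact: IH.
elim: T a ys => [|t T IH] a [|y ys] //= [] // hs hl h.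
- by move: hs hl; case: T {h} IH => // _ _ ->.
case: hs => hs; apply/andP; split; first exact: (h 0).
by apply: IH; split => // r hr; apply: (h r.+1).
Qed.

(** The tiles from row [r] on depend on those above only through the carried label. *)
Lemma cstep_split T a ys r : r <= size ys -> size ys < size T ->
  cstep T a ys = take r (cstep T a ys) ++ cstep (drop r T) (carry T a ys r) (drop r ys).
Proof.
elim: r T a ys => [|r IH] T a ys; first by rewrite take0 !drop0; case: T => [|? ?].
case: T ys => [|t T] [|y ys] //= hr hT.
by case: ifP => _ /=; congr cons; apply: IH.
Qed.

(** Conservation of labels in the first [r] tiles: what enters from the top and the right leaves to
    the left or at the bottom. *)
Lemma perm_carry T a ys r : r <= size ys -> size ys < size T ->
  perm_eq (carry T a ys r :: take r (cstep T a ys)) (a :: take r ys).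
Proof.
elim: r T a ys => [|r IH] T a ys; first by rewrite !take0; case: T.
case: T ys => [|t T] [|y ys] //= hr hT.
case: ifP => _ /=; apply: perm_trans (perm_swap _ _ _) _; last first.
  by rewrite perm_cons IH.
by rewrite perm_sym; apply: perm_trans (perm_swap _ _ _) _; rewrite perm_cons perm_sym IH.
Qed.

Lemma carryS T a ys r : r < size ys -> size ys < size T ->
  carry T a ys r.+1 =
  if nth Cross T r == Cross then carry T a ys r else nth 0 ys r.
Proof.
elim: r T a ys => [|r IH] [|t T] a [|y ys] //= hr hT.
  by case: T hT.
by rewrite -IH.
Qed.

Lemma nth_cstep T a ys r : r <= size ys -> size ys < size T ->
  nth 0 (cstep T a ys) r =
  if (r < size ys) && (nth Cross T r == Cross) then nth 0 ys r else carry T a ys r.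
Proof.
elim: T a ys r => [|t T IH] a [|y ys] [|r] //=; first by case: ifP.
by move=> hr hT; case: ifP => ht /=; rewrite IH.
Qed.

(* [okc T e]: a removable pipe entering column [T] from the right in row [e]
   either crosses it below a tile other than an unmarked bump, or uses two
   vertically adjacent unmarked bumps.  In both cases removing the pipe deletes
   the [e]-th tile of the column. *)
Definition okc (T : seq tile) (e : nat) : bool :=
  if nth Cross T e == Cross then (e == 0) || (nth Cross T e.-1 != Bump)
  else (nth Cross T e == Bump) && (nth Cross T e.+1 == Bump).

(** Row in which a pipe entering in row [e] leaves to the left; two bumps bring it down by one
    row. *)
Definition oute (T : seq tile) (e : nat) : nat :=
  if nth Cross T e == Cross then e else e.+1.

(** Inverse of [oute], read off from the column after deletion. An unmarked bump just above the
    insertion point must be what remains of two bumps, since a removable pipe never crosses directly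
    below an unmarked bump. *)
Definition ine (T : seq tile) (e : nat) : nat :=
  if (0 < e) && (nth Cross T e.-1 == Bump) then e.-1 else e.

Definition instile (T : seq tile) (e : nat) : tile :=
  if (0 < e) && (nth Cross T e.-1 == Bump) then Bump else Cross.

Definition insc (T : seq tile) (e : nat) : seq tile :=
  insat (ine T e) (instile T e) T.

Lemma okcol_delat T a ys e : e < size ys -> okcol T a ys -> okc T e ->
  [/\ okcol (delat e T) a (delat e ys),
      cstep (delat e T) a (delat e ys) = delat (oute T e) (cstep T a ys) &
      nth 0 (cstep T a ys) (oute T e) = nth 0 ys e].
Proof.
move=> he hok hc.
(* The condition on the tile above is dropped, so that the hypothesis passes to the tail of the
   column in the induction on [e]. *)
have {hc} : (nth Cross T e == Cross) || (nth Cross T e == Bump) && (nth Cross T e.+1 == Bump).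
  by move: hc; rewrite /okc; case: ifP.
rewrite /oute; elim: e T a ys he hok => [|e IH] [|t T] a [|y ys] // he /andP[h1 h2].
  case: eqP h1 h2 => [->|_] /= h1 h2 h; first by rewrite /delat /= !drop0.
  move/andP: h => [/eqP ->]; rewrite /delat /= !drop0.
  case: T h2 => [|t' T] //=; case: ys {he} => [|z ys] /=.
    by case/andP => _ /nilP -> /eqP ->.
  by case/andP => _ h /eqP ht; rewrite ht /= in h *; rewrite drop0.
rewrite [nth Cross _ _]/= [nth Cross _ e.+2]/= !delatS => h.
have [] := IH T (if t == Cross then a else y) ys he h2 h.
move: (delat e T) (delat e ys) h1 {h2 h} => T' ys'.
case: t => /= [h1|_|h1] h3 h4 h5; rewrite ?h1 ?h4 ?h3 ?andbT.
all: by move: h5; case: ifP => //= _ ->; rewrite delatS.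
Qed.

(** Here the condition on the tile above a crossing matters: after the deletion it tells a removed
    crossing from a merged pair of bumps. *)
Lemma insc_delat T e : e.+1 < size T -> okc T e -> insc (delat e T) (oute T e) = T.
Proof.
move=> he; rewrite /insc /okc /oute.
have hn i : nth Cross (delat e T) i = nth Cross T (if i < e then i else i.+1).
  exact: nth_delat.
case: eqP => [hT|hT] h.
  have hb : (0 < e) && (nth Cross (delat e T) e.-1 == Bump) = false.
    by case: e {he hT} h hn => //= e /negbTE h hn; rewrite hn ltnSn.
  by rewrite /ine /instile hb -hT insat_delat //; lia.
case/andP: h => /eqP h1 h2.
have hb : (0 < e.+1) && (nth Cross (delat e T) e.+1.-1 == Bump).
  by rewrite /= hn ltnn.
by rewrite /ine /instile hb /= -h1 insat_delat //; lia.
Qed.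

(** An insertion point below the whole column moves up by one row, because the last tile is an
    unmarked bump. *)
Lemma ine_le_last T e : e <= size T -> nth Cross T (size T).-1 = Bump ->
  0 < size T -> ine T e <= (size T).-1.
Proof.
move=> h1 h2 h3; rewrite /ine.
case: ifP => [_|h]; first by lia.
have [//|h4] := leqP e (size T).-1.
have he : e = size T by lia.
by rewrite he h3 h2 in h.
Qed.

Lemma nth_insc T e i : e <= size T ->
  nth Cross (insc T e) i =
  if i < ine T e then nth Cross T i
  else if i == ine T e then instile T e else nth Cross T i.-1.
Proof. by move=> h; rewrite nth_insat // /ine; case: ifP; lia. Qed.

Lemma okc_insc T e : e <= size T -> okc (insc T e) (ine T e).
Proof.
move=> he; rewrite /okc !nth_insc // ltnn eqxx.
have -> : ((ine T e).-1 == ine T e) = (ine T e == 0) by lia.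
have -> : ((ine T e).-1 < ine T e) = (0 < ine T e) by lia.
have -> : ((ine T e).+1 < ine T e) = false by lia.
have -> : ((ine T e).+1 == ine T e) = false by lia.
rewrite /ine /instile; case hb: ((0 < e) && _) => /=.
  by case/andP: hb => h1 /eqP ->.
by case: e {he} hb => //= e ->.
Qed.

Lemma oute_insc T e : e <= size T -> oute (insc T e) (ine T e) = e.
Proof.
move=> he; rewrite /oute !nth_insc // ltnn eqxx /ine /instile; case hb: ((0 < e) && _) => //=.
by case/andP: hb => h _; rewrite prednK.
Qed.

Lemma delat_insc T e : e <= size T -> delat (ine T e) (insc T e) = T.
Proof. by move=> h; apply: delat_insat; rewrite /ine; case: ifP => _; lia. Qed.

Lemma okcol_insat_bump T a ys i j : i <= size ys -> nth Cross T i = Bump ->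
  okcol T a ys -> okcol (insat i Bump T) a (insat i j ys).
Proof.
elim: i T a ys => [|i IH] [|t T] a ys //.
  move=> _ /= ->; rewrite /insat !take0 /= !drop0 /=.
  by case: ys => [|y ys] //= ->.
case: ys => [|y ys] // hi ht /andP[h1 h2].
by rewrite !insatS /= h1 IH.
Qed.

Lemma okcol_insat_cross T a ys i j : i <= size ys -> carry T a ys i < j ->
  okcol T a ys -> okcol (insat i Cross T) a (insat i j ys).
Proof.
elim: i T a ys => [|i IH] [|t T] a ys //.
  by move=> _ /= h h'; rewrite /insat !take0 /= !drop0 /= h.
case: ys => [|y ys] // hi ht /andP[h1 h2].
by rewrite !insatS /= h1 IH.
Qed.

(** Only an inserted crossing imposes a condition on labels, an unmarked bump being always legal.
    The outgoing labels are found by deleting the pipe again from the enlarged column. *)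
Lemma okcol_insc T a ys e j : e <= size T ->
  okcol T a ys -> (instile T e = Cross -> carry T a ys (ine T e) < j) ->
  okcol (insc T e) a (insat (ine T e) j ys) /\
  cstep (insc T e) a (insat (ine T e) j ys) = insat e j (cstep T a ys).
Proof.
move=> he hok hj.
have hs := size_okcol hok.
have hi : ine T e <= size ys.
  have := ine_le_last he; rewrite hs /= (okcol_last hok) => h; exact: h.
have hok' : okcol (insc T e) a (insat (ine T e) j ys).
  rewrite /insc; move: hj hi; rewrite /ine /instile; case: ifP => /= [/andP[_ /eqP h] _|_ hj] hi.
    exact: okcol_insat_bump.
  exact: okcol_insat_cross (hj _) _.
split=> //.
have hi' : ine T e < size (insat (ine T e) j ys) by rewrite size_insat.
have [_] := okcol_delat hi' hok' (okc_insc he).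
rewrite oute_insc // delat_insc // delat_insat // => -> h.
rewrite nth_insat // ltnn eqxx in h.
by rewrite -{2}h insat_delat // size_cstep size_insat; lia.
Qed.

(** The tiles tested for row [f] are affected by the deletion only if [e] and [f] are adjacent rows,
    and there [okc T e] leaves few combinations of tiles to inspect. *)
Lemma okc_delat T e f : e != f -> okc T e ->
  okc (delat e T) (if f < e then f else f.-1) = okc T f.
Proof.
move=> hef; rewrite /okc !nth_delat => he.
have [hfe|hfe] := ltnP f e.
  have -> : f.-1 < e by lia.
  rewrite /= hfe; have [hf1|hf1] := ltnP f.+1 e; first by [].
  have ef : e = f.+1 by lia.
  by move: he; rewrite ef /=; case: (nth Cross T f.+1); case: (nth Cross T f) => //=;
     case: (nth Cross T f.+2).
have {hfe} hfe : e < f by lia.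
case: f hfe {hef} => // f hfe /=.
have -> : (f < e) = false by lia.
have -> : (f.+1 < e) = false by lia.
case: f hfe => [|f] /= hfe.
  have e0 : e = 0 by lia.
  by move: he; rewrite e0 /=; case: (nth Cross T 0) => //=; case: (nth Cross T 1).
have [hfe'|hfe'] := ltnP f e; last by [].
have ef : e = f.+1 by lia.
by move: he; rewrite ef /=; case: (nth Cross T f.+1) => //=; case: (nth Cross T f.+2) => //=;
   case: (nth Cross T f).
Qed.

(* The shape of the entrance column of a removable pipe. *)
Definition crosses_bumps (T : seq tile) : bool :=
  has (fun t => T == nseq t Cross ++ nseq (size T - t) Bump) (iota 0 (size T)).

Lemma crosses_bumpsP T :
  reflect (exists2 t, t < size T & T = nseq t Cross ++ nseq (size T - t) Bump)
          (crosses_bumps T).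
Proof.
apply: (iffP hasP) => [[t]|[t ht hT]].
  by rewrite mem_iota => h /eqP e; exists t.
by exists t; rewrite ?mem_iota //; apply/eqP.
Qed.

Lemma eq_crosses_bumps T t : t <= size T ->
  (forall r, r < size T -> nth Cross T r = if r < t then Cross else Bump) ->
  T = nseq t Cross ++ nseq (size T - t) Bump.
Proof.
move=> ht h; apply: (@eq_from_nth _ Cross) => [|r hr].
  by rewrite size_cat !size_nseq; lia.
rewrite nth_cat size_nseq !nth_nseq h //.
by case: ltnP => // htr; rewrite ifT //; lia.
Qed.

Lemma nth_crosses_bumps t s r :
  nth Cross (nseq t Cross ++ nseq s Bump) r = if (r < t) || (t + s <= r) then Cross else Bump.
Proof.
rewrite nth_cat size_nseq !nth_nseq; case: ltnP => //= h.
by case: ltnP => h2; case: leqP => h3 //; lia.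
Qed.

(** A deleted crossing does not lie below an unmarked bump and a deleted bump is followed by another
    one. Hence putting the tile back cannot spoil the shape of a block of crossings above a block of
    bumps. *)
Lemma crosses_bumps_delat T e : e.+1 < size T -> nth Cross T (size T).-1 = Bump ->
  okc T e -> crosses_bumps (delat e T) = crosses_bumps T.
Proof.
move=> hs hl hc.
have hsd : size (delat e T) = (size T).-1 by rewrite size_delat //; lia.
have hn i : nth Cross (delat e T) i = nth Cross T (if i < e then i else i.+1).
  exact: nth_delat.
apply/crosses_bumpsP/crosses_bumpsP => [[t]|[t]]; rewrite hsd => ht hT.
  have hT' i : i < (size T).-1 -> nth Cross T (if i < e then i else i.+1) =
      if i < t then Cross else Bump.
    move=> hi; rewrite -hn hT nth_crosses_bumps; congr (if _ then _ else _).
    have -> : (t + ((size T).-1 - t) <= i) = false by lia.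
    by rewrite orbF.
  have hlo i : i < e -> nth Cross T i = if i < t then Cross else Bump.
    by move=> hi; have := hT' i; rewrite hi => -> //; lia.
  have hhi i : e < i -> i < size T -> nth Cross T i = if i.-1 < t then Cross else Bump.
    move=> hi hi'; have := hT' i.-1; have -> : (i.-1 < e) = false by lia.
    by rewrite prednK => [->|] //; lia.
  have [he|he] := eqVneq (nth Cross T e) Cross.
    have het : e <= t.
      move: hc; rewrite /okc he eqxx; case: e hlo {hs hsd hn hT' hhi he hT} => //= e' hlo.
      by rewrite hlo //; case: ltnP.
    exists t.+1; first by lia.
    apply: eq_crosses_bumps => [|r hr]; first by lia.
    case: (ltngtP r e) => h1; last by rewrite h1 he ltnS het.
      by rewrite hlo //; case: ltnP => h2; case: ltnP => // h3; lia.
    by rewrite hhi //; case: ltnP => h2; case: ltnP => // h3; lia.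
  move: (hc); rewrite /okc (negbTE he) => /andP[/eqP h1 /eqP h2].
  exists t; first by lia.
  have het : t <= e.
    by move: (hhi e.+1); rewrite h2 ltnSn hs /= => /(_ isT isT); case: ltnP.
  apply: eq_crosses_bumps => [|r hr]; first by lia.
  case: (ltngtP r e) => h3; last by rewrite h3 h1 ltnNge het.
    exact: hlo.
  by rewrite hhi //; case: ltnP => h4; case: ltnP => // h5; lia.
have hT' i : i < size T -> nth Cross T i = if i < t then Cross else Bump.
  move=> hi; rewrite {1}hT nth_crosses_bumps; congr (if _ then _ else _).
  have -> : (t + (size T - t) <= i) = false by lia.
    by rewrite orbF.
have key t' : t' < (size T).-1 -> (forall i, i < (size T).-1 ->
    nth Cross T (if i < e then i else i.+1) = if i < t' then Cross else Bump) ->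
  exists2 t0, t0 < (size T).-1 & delat e T = nseq t0 Cross ++ nseq ((size T).-1 - t0) Bump.
  move=> ht' h; exists t' => //; rewrite -hsd; apply: eq_crosses_bumps => [|r].
    by rewrite hsd; lia.
  by rewrite hsd hn; apply: h.
apply: (key (if e < t then t.-1 else t)).
  case: ifP => h; first by lia.
  have := hc; rewrite /okc hT' ?h /=; last by lia.
  by rewrite hT' //; case: ltnP => // h2; lia.
move=> i hi; have hi' : i.+1 < size T by lia.
case: (ltnP i e) => h1; rewrite hT' ?(ltnW hi') //;
  case: (ltnP e t) => h2; case: ltnP => h3 //; case: ltnP => // h4; lia.
Qed.

Lemma ine_delat T e : okc T e -> ine (delat e T) (oute T e) = e.
Proof.
rewrite /okc /oute /ine; case: eqP => [hT|hT].
  by case: e {hT} => //= e; rewrite nth_delat ltnSn => /negbTE ->.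
by case/andP => _ h; rewrite /= nth_delat ltnn h.
Qed.

(** * The pattern 1423 *)

(* Small labels are those below [j].  No column with a small top label brings
   the last small label lying above a large [d] down across [d]. *)
Definition small_above (j d : nat) (s : seq nat) : bool :=
  (d \in s) && has (fun x => x < j) (take (index d s) s).

(** Follow the column down to its first bump. There the small label [a] leaves above [d]; until then
    the crossings let the row labels through, so a small one met on the way stays above [d]. *)
Lemma small_above_cstep T a j d ys : a < j -> j < d ->
  small_above j d ys -> small_above j d (cstep T a ys).
Proof.
move=> haj hjd.
have had : (a == d) = false by apply/negbTE/eqP; lia.
have first ys' : d \in ys' -> small_above j d (a :: ys').
  by move=> h; rewrite /small_above inE h orbT /= had /= haj.
elim: ys T => [|y ys IH] [|t T] //= h.
  by apply: first; case/andP: h.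
have hd : d \in y :: ys by case/andP: h.
have [yd|yd] := eqVneq y d.
  by move: h; rewrite /small_above /= yd eqxx andbF.
have {hd} hd : d \in ys by move: hd; rewrite inE eq_sym (negbTE yd).
case: ifP => _; last first.
  apply: first; rewrite (perm_mem (perm_cstep _ _ _)) inE hd orbT //.
move: h; rewrite /small_above /= (negbTE yd) /= !inE [d == y]eq_sym (negbTE yd) /=.
case: (y < j) => /= [_|].
  by rewrite andbT (perm_mem (perm_cstep _ _ _)) inE hd orbT.
exact: IH.
Qed.

(** The lists hold the labels above and below the row of [j]. With [j] between them, a small label,
    [d], [j] and [b] form 1423 in this order. *)
Definition pattern (j : nat) (y1 y2 : seq nat) : Prop :=
  exists d b, [/\ small_above j d y1, b \in y2, j < b & b < d].

(** In the column cut off after [r] tiles the carried label becomes the last output. This makes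
    [small_above_cstep] applicable to the upper part of a column. *)
Lemma rcons_carry T a ys r : r <= size ys -> size ys < size T ->
  rcons (take r (cstep T a ys)) (carry T a ys r) = cstep (take r T) a (take r ys).
Proof.
elim: r T a ys => [|r IH] T a ys.
  by rewrite !take0; case: T.
case: T ys => [|t T] [|y ys] //= hr hT.
by case: ifP => _ /=; rewrite IH.
Qed.

Lemma small_above_rcons j d s k : d != k -> small_above j d (rcons s k) -> small_above j d s.
Proof.
move=> hdk /andP[]; rewrite mem_rcons inE (negbTE hdk) /= => hd.
rewrite -cats1 index_cat hd take_cat index_mem hd => h.
by rewrite /small_above hd.
Qed.

(* A label pattern 1423 with [j] in the role of 2 survives in the labels leaving
   a column, and it is created if the crossing inserted for [j] is illegal. *)
Lemma pattern_cstep T a ys e j :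
  okcol T a ys -> uniq (a :: ys) -> j \notin a :: ys -> a < j -> e <= size T ->
  pattern j (take (ine T e) ys) (drop (ine T e) ys) \/
    (instile T e = Cross /\ j < carry T a ys (ine T e)) ->
  pattern j (take e (cstep T a ys)) (drop e (cstep T a ys)).
Proof.
move=> hok hu hj haj he hp.
have hs := size_okcol hok.
have hsT : size ys < size T by rewrite hs.
have hi : ine T e <= size ys.
  by have := ine_le_last he; rewrite hs /= (okcol_last hok); apply.
have huz : uniq (cstep T a ys) by rewrite (perm_uniq (perm_cstep _ _ _)).
have hz := cstep_split a hi hsT.
have hdrop : drop (ine T e) (cstep T a ys) =
    cstep (drop (ine T e) T) (carry T a ys (ine T e)) (drop (ine T e) ys).
  by rewrite {1}hz drop_size_cat // size_takel // size_cstep; lia.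
have hrc := rcons_carry a hi hsT.
have hpc := perm_carry a hi hsT.
move: hp hi hz hdrop hrc hpc; rewrite /ine /instile.
(* If a bump is doubled, the label carried into it leaves in row [e.-1]. So the first [e] outputs
   are exactly those of the column cut off after [e.-1] tiles, and [b], which is not that label,
   leaves further down. *)
case hb: ((0 < e) && _) => hp hi hz hdrop hrc hpc.
  case/andP: hb => e0 /eqP hT.
  case: hp => [[d [b [h1 h2 h3 h4]]]|[]//].
  have hkz : nth 0 (cstep T a ys) e.-1 = carry T a ys e.-1.
    by rewrite nth_cstep // hT andbF.
  have hez : e.-1 < size (cstep T a ys) by rewrite size_cstep ltnS.
  exists d, b; split=> //.
    have := small_above_cstep (take e.-1 T) haj (ltn_trans h3 h4) h1.
    by rewrite -hrc -hkz -take_nth // prednK.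
  have hud := drop_uniq e.-1 huz; rewrite hdrop (perm_uniq (perm_cstep _ _ _)) in hud.
  have hbk : b != carry T a ys e.-1.
    by apply: contraNneq (andP hud).1 => <-.
  have : b \in drop e.-1 (cstep T a ys).
    by rewrite hdrop (perm_mem (perm_cstep _ _ _)) inE h2 orbT.
  by rewrite (drop_nth 0) // hkz inE (negbTE hbk) prednK.
have hkj : carry T a ys e != j.
  apply: contraNneq hj => <-.
  have : carry T a ys e \in carry T a ys e :: take e (cstep T a ys) by rewrite mem_head.
  rewrite (perm_mem hpc) !inE.
  by case/orP => [->//|/mem_take ->]; rewrite orbT.
(* If the inserted crossing is legal, the pattern was already present on the right. The label
   carried into the crossing is then smaller than [j], hence different from [d], and can be cut off
   at the end of the upper outputs. *)
have [hk|hk] := ltnP j (carry T a ys e); last first.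
  have {hk hkj} hk : carry T a ys e < j by lia.
  case: hp => [[d [b [h1 h2 h3 h4]]]|[_]]; last by lia.
  have hjd : j < d by lia.
  exists d, b; split => //; last first.
    by rewrite hdrop (perm_mem (perm_cstep _ _ _)) inE h2 orbT.
  apply: (@small_above_rcons _ _ _ (carry T a ys e)); first by apply/eqP; lia.
  by rewrite hrc; apply: small_above_cstep.
have e0 : 0 < e.
  by case: e hk {he hp hi hb hz hdrop hrc hpc hkj} => //; case: (T) => [|? ?] /=; lia.
(* The tile above the illegal crossing sends a label [d] larger than its bottom
   label to the left, and the small top label [a] has left the column above [d]. *)
move: hb; rewrite e0 /= => hTb.
have he1 : e.-1 < size ys by lia.
have hez : e.-1 < size (cstep T a ys) by rewrite size_cstep; lia.
have hcs : carry T a ys e = if nth Cross T e.-1 == Cross then carry T a ys e.-1 else nth 0 ys e.-1.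
  by rewrite -carryS // prednK.
have hnz := nth_cstep a (ltnW he1) hsT; rewrite he1 /= in hnz.
case/okcolP: (hok) => _ _ /(_ _ he1) hto.
pose d := nth 0 (cstep T a ys) e.-1.
have hkd : carry T a ys e < d.
  rewrite /d hnz hcs; move: hTb hto; case: (nth Cross T e.-1) => //=.
exists d, (carry T a ys e); split=> //; last first.
  by rewrite hdrop (perm_mem (perm_cstep _ _ _)) mem_head.
have htk : take e (cstep T a ys) = rcons (take e.-1 (cstep T a ys)) d.
  by rewrite -take_nth // prednK.
have hdn : d \notin take e.-1 (cstep T a ys).
  by have := take_uniq e huz; rewrite htk rcons_uniq => /andP[].
rewrite /small_above htk mem_rcons mem_head -cats1 index_cat (negbTE hdn) /= eqxx addn0.
rewrite take_size_cat //; apply/hasP; exists a => //.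
have : a \in carry T a ys e.-1 :: take e.-1 (cstep T a ys).
  by rewrite (perm_mem (perm_carry a (ltnW he1) hsT)) mem_head.
rewrite inE => /orP[/eqP ha|//].
by move: hkd; rewrite hcs /d hnz; case: ifP hcs => _ hcs; lia.
Qed.

(** * Sequences of columns *)

Fixpoint run (cs : seq (seq tile)) (s : seq nat) : seq nat :=
  match cs, s with
  | T :: cs', a :: s' => cstep T a (run cs' s')
  | _, _ => [::]
  end.

Fixpoint okrun (cs : seq (seq tile)) (s : seq nat) : bool :=
  match cs, s with
  | T :: cs', a :: s' => okcol T a (run cs' s') && okrun cs' s'
  | [::], [::] => true
  | _, _ => false
  end.

(** The test stops at the entrance column: the pipe travels down and left and never meets the
    columns to the right. *)
Fixpoint remv (j : nat) (cs : seq (seq tile)) (s : seq nat) : bool :=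
  match cs, s with
  | T :: cs', a :: s' =>
      if a == j then crosses_bumps T
      else okc T (index j (run cs' s')) && remv j cs' s'
  | _, _ => false
  end.

Fixpoint delrun (j : nat) (cs : seq (seq tile)) (s : seq nat) : seq (seq tile) :=
  match cs, s with
  | T :: cs', a :: s' =>
      if a == j then cs'
      else delat (index j (run cs' s')) T :: delrun j cs' s'
  | _, _ => [::]
  end.

(* The inverse of [delrun], from the row [e] in which pipe [j] has to exit. *)
Fixpoint insrun (j e : nat) (cs : seq (seq tile)) (s : seq nat) : seq (seq tile) :=
  let col := nseq e Cross ++ nseq ((size cs).+1 - e) Bump in
  match cs, s with
  | T :: cs', a :: s' =>
      if a < j then insc T e :: insrun j (ine T e) cs' s' else col :: cs
  | _, _ => [:: col]
  end.

Lemma okrun_size cs s : okrun cs s -> size cs = size s.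
Proof. by elim: cs s => [|T cs IH] [|a s] //= /andP[_ /IH ->]. Qed.

Lemma perm_run cs s : size cs = size s -> perm_eq (run cs s) s.
Proof.
elim: cs s => [|T cs IH] [|a s] //= [] /IH h.
by apply: perm_trans (perm_cstep _ _ _) _; rewrite perm_cons.
Qed.

Lemma okrun_perm cs s : okrun cs s -> perm_eq (run cs s) s.
Proof. by move/okrun_size; apply: perm_run. Qed.

Lemma remv_mem j cs s : remv j cs s -> j \in s.
Proof.
elim: cs s => [|T cs IH] [|a s] //=; rewrite inE eq_sym; case: eqP => //= _.
by case/andP => _ /IH.
Qed.

(** The crossings carry [j] down to row [t], where the first bump sends it out; each further bump
    moves a label down by one row. *)
Lemma crosses_bumps_cstep t s j ys : t <= size ys ->
  cstep (nseq t Cross ++ nseq s Bump) j ys = insat t j ys.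
Proof.
elim: t ys j => [|t IH] ys j /=; last by case: ys => //= y ys h; rewrite IH.
rewrite /insat take0 drop0 /= => _.
by elim: s j ys => [|s IHs] j [|y ys] //=; rewrite IHs.
Qed.

Lemma crosses_bumps_okcol t j ys : t <= size ys -> all (fun y => j < y) ys ->
  okcol (nseq t Cross ++ nseq ((size ys).+1 - t) Bump) j ys.
Proof.
elim: t ys j => [|t IH] ys j /=.
  by move=> _ _; elim: ys j => [|y ys IHs] j //=; apply: IHs.
by case: ys => //= y ys h /andP[-> hy]; rewrite subSS IH.
Qed.

Lemma delrun_ok (j : nat) cs (s : seq nat) : uniq s -> okrun cs s -> remv j cs s ->
  okrun (delrun j cs s) (rem j s) /\
  run (delrun j cs s) (rem j s) = rem j (run cs s).
Proof.
elim: cs s => [|T cs IH] [|a s] //= /andP[has hu] /andP[hT hok].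
have hp := okrun_perm hok.
case: eqP => [aj|/eqP aj] hr.
  split=> //; case/crosses_bumpsP: hr => t ht ->.
  rewrite (size_okcol hT) ltnS in ht *.
  rewrite crosses_bumps_cstep // aj rem_insat //.
  by rewrite (perm_mem hp) -aj.
case/andP: hr => hc hr; have [h1 h2] := IH _ hu hok hr.
have hj : j \in run cs s by rewrite (perm_mem hp) (remv_mem hr).
have hlt : index j (run cs s) < size (run cs s) by rewrite index_mem.
have [h3 h4 h5] := okcol_delat hlt hT hc.
rewrite /= h2 [rem j (run _ _)]rem_delat h3 h1 h4; split=> //.
rewrite rem_delat; congr delat.
rewrite nth_index // in h5; rewrite -{2}h5 index_uniq //.
  rewrite size_cstep /oute; case: ifP => _; lia.
by rewrite (perm_uniq (perm_cstep _ _ _)) /= (perm_mem hp) has (perm_uniq hp).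
Qed.

Lemma index_delat (j j' : nat) (s : seq nat) : j != j' -> j \in s ->
  index j' (rem j s) = if index j' s < index j s then index j' s else (index j' s).-1.
Proof.
move=> hj; elim: s => // y s IH; rewrite inE /=.
have [->|hy] := eqVneq y j; first by rewrite (negbTE hj).
move=> /= hjs; have {}IH := IH hjs.
have [//|hy'] := eqVneq y j'; rewrite IH ltnS; case: ltnP => // hle.
rewrite prednK //= lt0n; apply: contraNneq hj => f0.
have e0 : index j s = 0 by move: hle; rewrite f0 leqn0 => /eqP.
have hs : 0 < size s by move: hjs; case: (s).
by rewrite -(nth_index 0 hjs) e0 -f0 nth_index // -index_mem f0.
Qed.

(** In the columns traversed by both pipes the deletions are independent. If the entrance column of
    [j] disappears, the condition on [j'] there disappears too, but it held anyway: a row of such a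
    column is either the top row or a crossing below a crossing, or a bump above a bump. *)
Lemma remv_delrun (j j' : nat) cs (s : seq nat) : uniq s -> okrun cs s -> remv j cs s -> j != j' ->
  remv j' (delrun j cs s) (rem j s) = remv j' cs s.
Proof.
move=> + + + hjj; elim: cs s => [|T cs IH] [|a s] //= /andP[has hu] /andP[hT hok].
have hp := okrun_perm hok.
have hsT := size_okcol hT.
case: eqP => [aj|/eqP aj] hr.
  rewrite aj (negbTE hjj); case: (boolP (remv j' cs s)) => h; last by rewrite andbF.
  rewrite andbT; apply/esym; case/crosses_bumpsP: hr => t ht hT'.
  have hj : index j' (run cs s) < size (run cs s).
    by rewrite index_mem (perm_mem hp) (remv_mem h).
  rewrite hT' /okc !nth_crosses_bumps hsT.
  have hts : t + ((size (run cs s)).+1 - t) = (size (run cs s)).+1 by lia.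
  rewrite hts; move: hj; set f := index _ _; set m := size _ => hj.
  have -> : (m.+1 <= f) = false by lia.
  have -> : (m.+1 <= f.-1) = false by lia.
  have -> : (m.+1 <= f.+1) = false by lia.
  rewrite !orbF; case: (ltnP f t) => h1 /=.
    have -> : f.-1 < t by lia.
    by rewrite orbT.
  by have -> : (f.+1 < t) = false by lia.
case/andP: hr => hc hr; rewrite /=; have [_ hrun] := delrun_ok hu hok hr.
have hj : j \in run cs s by rewrite (perm_mem hp) (remv_mem hr).
have hlt : index j (run cs s) < size (run cs s) by rewrite index_mem.
case: eqP => [aj'|_].
  apply: crosses_bumps_delat => //; rewrite hsT //=.
  exact: okcol_last hT.
rewrite IH // hrun index_delat //; congr (_ && _); apply: okc_delat => //.
apply: contraNneq hjj => hi.
by rewrite -(nth_index 0 hj) hi nth_index // -index_mem -hi.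
Qed.

(** A removed pipe can be recovered from its exit row and the remaining columns. Since the top
    labels increase, comparing them with [j] locates the entrance column. *)
Lemma insrun_delrun (j : nat) cs (s : seq nat) : sorted ltn s -> okrun cs s -> remv j cs s ->
  insrun j (index j (run cs s)) (delrun j cs s) (rem j s) = cs.
Proof.
elim: cs s => [|T cs IH] [|a s] // hs /= /andP[hT hok].
have hu : uniq (a :: s) by apply: sorted_uniq hs; [exact: ltn_trans | exact: ltnn].
have /= /andP[has hu'] := hu.
have hp := okrun_perm hok.
have hsT := size_okcol hT.
case: eqP => [aj|/eqP aj] hr.
  case/crosses_bumpsP: hr => t ht hT'.
  have htm : t <= size (run cs s) by rewrite -ltnS -hsT.
  have hj : j \notin run cs s by rewrite (perm_mem hp) -aj.
  rewrite aj hT' crosses_bumps_cstep // index_insat // hsT (perm_size hp) -(okrun_size hok).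
  have hsz := okrun_size hok.
  case: s cs hs hsz {IH hT hu has hu' hok hp hsT ht hT' htm hj} => [|b s] [|T' cs] //= + _.
  by case/andP; rewrite aj => h _; rewrite ltnNge (ltnW h).
case/andP: hr => hc hr; rewrite /=; have [_ hrun] := delrun_ok hu' hok hr.
have hj : j \in run cs s by rewrite (perm_mem hp) (remv_mem hr).
have hlt : index j (run cs s) < size (run cs s) by rewrite index_mem.
have [h3 h4 h5] := okcol_delat hlt hT hc.
have -> : index j (cstep T a (run cs s)) = oute T (index j (run cs s)).
  rewrite nth_index // in h5; rewrite -{1}h5 index_uniq //.
    by rewrite size_cstep /oute; case: ifP => _; lia.
  by rewrite (perm_uniq (perm_cstep _ _ _)) /= (perm_mem hp) has (perm_uniq hp).
have -> : a < j.
  have := order_path_min ltn_trans hs; move/allP; apply.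
  by rewrite -(perm_mem hp).
rewrite insc_delat ?hsT // ine_delat // IH //.
exact: path_sorted hs.
Qed.

(** The insertion works from the left boundary to the right. By [pattern_cstep], an illegal crossing
    in any column would create a pattern that is carried back through all columns to its left, up to
    the exit row [e], where it is excluded. *)
Lemma insrun_ok (j : nat) e cs (s : seq nat) : sorted ltn s -> j \in s -> e <= size cs ->
  okrun cs (rem j s) ->
  ~ pattern j (take e (run cs (rem j s))) (drop e (run cs (rem j s))) ->
  [/\ okrun (insrun j e cs (rem j s)) s,
      run (insrun j e cs (rem j s)) s = insat e j (run cs (rem j s)),
      remv j (insrun j e cs (rem j s)) s &
      delrun j (insrun j e cs (rem j s)) s = cs].
Proof.
elim: s cs e => [|a s IH] cs e // hs; rewrite inE /=.
have hu : uniq (a :: s) by apply: sorted_uniq hs; [exact: ltn_trans | exact: ltnn].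
have /= /andP[has hu'] := hu.
have hmin := order_path_min ltn_trans hs.
have [<-|aj] := eqVneq a j.
  move=> _ he hok _.
  have hp := okrun_perm hok.
  have hsz := okrun_size hok.
  have -> : insrun a e cs s = (nseq e Cross ++ nseq ((size cs).+1 - e) Bump) :: cs.
    case: cs s hsz {IH hs hu has hu' he hok hp} hmin => [|T cs] [|b s] //= _ /andP[h _].
    by rewrite ltnNge (ltnW h).
  have hsr : size cs = size (run cs s) by rewrite (perm_size hp).
  rewrite /= eqxx; split=> //.
  - rewrite hok andbT hsr; apply: crosses_bumps_okcol; first by rewrite -hsr.
    by rewrite (perm_all _ hp).
  - by rewrite crosses_bumps_cstep // -hsr.
  apply/crosses_bumpsP; exists e; rewrite size_cat !size_nseq subnKC //; exact: leqW.
move=> /= hj he.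
case: cs he => [|T cs] //= he /andP[hT hok] hpat.
have haj : a < j by move/allP: hmin; apply.
have hp := okrun_perm hok.
have hsT := size_okcol hT.
have hau : uniq (a :: run cs (rem j s)).
  by rewrite /= (perm_mem hp) (perm_uniq hp) rem_uniq // andbT; apply: contra has; apply: mem_rem.
have hja : j \notin a :: run cs (rem j s).
  by rewrite inE eq_sym (negbTE aj) /= (perm_mem hp) mem_rem_uniqF.
have hesT : e <= size T.
  by rewrite hsT (perm_size hp) -(okrun_size hok).
have hie : ine T e <= size cs.
  have := ine_le_last hesT; rewrite hsT /= (okcol_last hT) (perm_size hp) -(okrun_size hok).
  by apply.
have [|h1 h2 h3 h4] := IH cs (ine T e) (path_sorted hs) hj hie hok.
  by move=> h; apply: hpat; apply: pattern_cstep => //; left.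
have hcar : instile T e = Cross -> carry T a (run cs (rem j s)) (ine T e) < j.
  move=> h; rewrite ltnNge leq_eqVlt negb_or; apply/andP; split.
    have hiz : ine T e <= size (run cs (rem j s)) by rewrite (perm_size hp) -(okrun_size hok).
    have hsz : size (run cs (rem j s)) < size T by rewrite hsT.
    apply: contraNneq hja => jk; rewrite {1}jk.
    have := mem_head (carry T a (run cs (rem j s)) (ine T e)) (take (ine T e) (cstep T a (run cs (rem j s)))).
    rewrite (perm_mem (perm_carry a hiz hsz)) !inE => /orP[->//|/mem_take ->].
    by rewrite orbT.
  by apply/negP => h'; apply: hpat; apply: pattern_cstep => //; right.
have [h5 h6] := okcol_insc hesT hT hcar.
rewrite haj /= (negbTE aj) h2; split.
- by rewrite h5 h1.
- exact: h6.
- rewrite index_insat ?okc_insc //; first by rewrite (perm_size hp) -(okrun_size hok).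
  by apply: contra hja => h; rewrite inE h orbT.
rewrite index_insat ?delat_insc ?h4 //; first by rewrite (perm_size hp) -(okrun_size hok).
by apply: contra hja => h; rewrite inE h orbT.
Qed.

(** * Traced pipes and columns *)

(* Here [p] is the vertical and [q] the horizontal pipe of the crossing. *)
Definition crosses (T : seq tile) (a : nat) (ys : seq nat) (p q : nat) : bool :=
  [&& q \in ys, nth Cross T (index q ys) == Cross & carry T a ys (index q ys) == p].

Lemma carry_mem T a ys r : r <= size ys -> size ys < size T ->
  carry T a ys r \in a :: take r ys.
Proof. by move=> h1 h2; rewrite -(perm_mem (perm_carry a h1 h2)) mem_head. Qed.

Lemma leq_index_notin (x : nat) r (z : seq nat) : r <= size z -> x \notin take r z -> r <= index x z.
Proof.
move=> hr; case: (boolP (x \in z)) => hx; first by rewrite in_take // -leqNgt.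
by move=> _; move: hx; rewrite -index_mem -leqNgt => /(leq_trans hr).
Qed.

(** Pipes never climb on their way to the left: the outputs above row [index q ys] come from [a] and
    from the labels above [q]. *)
Lemma index_cstep T (a : nat) (ys : seq nat) (q : nat) : uniq (a :: ys) -> size ys < size T -> q \in ys ->
  index q ys <= index q (cstep T a ys).
Proof.
move=> hu hT hq; have hlt : index q ys < size ys by rewrite index_mem.
apply: leq_index_notin; first by rewrite size_cstep; lia.
apply/negP => h.
have : q \in a :: take (index q ys) ys.
  by rewrite -(perm_mem (perm_carry a (ltnW hlt) hT)) inE h orbT.
rewrite inE in_take // ltnn orbF => /eqP qa.
by move: hu; rewrite -qa /= hq.
Qed.

(** At the row in which [q] enters, [p] has either left the column already or is the carried label.
    In the first case the order is kept; in the second it is reversed exactly if this tile is a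
    crossing. *)
Lemma crosses_order T (a : nat) (ys : seq nat) (p q : nat) : uniq (a :: ys) -> size ys < size T ->
  q \in a :: ys -> index p (a :: ys) < index q (a :: ys) ->
  (index q (cstep T a ys) < index p (cstep T a ys)) = crosses T a ys p q /\
  crosses T a ys q p = false.
Proof.
move=> hu hT hq hpq.
have aq : (a == q) = false.
  by apply/negbTE; apply: contraTneq hpq => ->; rewrite /= eqxx ltn0.
have {}hq : q \in ys by move: hq; rewrite inE eq_sym aq.
move: hpq; rewrite [index q _]/= aq => hpq.
have hlt : index q ys < size ys by rewrite index_mem.
have hpc := perm_carry a (ltnW hlt) hT.
have hnz := nth_cstep a (ltnW hlt) hT; rewrite hlt nth_index //= in hnz.
have huz : uniq (cstep T a ys) by rewrite (perm_uniq (perm_cstep _ _ _)).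
have hsz := size_cstep T a ys.
have hp : p \in a :: take (index q ys) ys.
  have -> : a :: take (index q ys) ys = take (index q ys).+1 (a :: ys) by [].
  by rewrite in_take_leq //; apply: ltnW.
have hzq : index q ys <= index q (cstep T a ys) by apply: index_cstep.
split; last first.
  apply/negbTE/negP => /and3P[h1 _ /eqP h2].
  have hlt' : index p ys < size ys by rewrite index_mem.
  have := carry_mem a (ltnW hlt') hT; rewrite h2 inE eq_sym aq /= in_take // => h3.
  move: hpq; rewrite /=; case: eqP => // [pa|]; last by lia.
  by move: hu; rewrite /= pa h1.
have huk : uniq (carry T a ys (index q ys) :: take (index q ys) (cstep T a ys)).
  rewrite (perm_uniq hpc); have -> : a :: take (index q ys) ys = take (index q ys).+1 (a :: ys) by [].
  exact: take_uniq.
rewrite /crosses hq /=.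
have hqz : q \in cstep T a ys by rewrite (perm_mem (perm_cstep _ _ _)) inE hq orbT.
move: hp; rewrite -(perm_mem hpc) inE => /orP[/eqP pk|hp]; last first.
  have hpz : index p (cstep T a ys) < index q ys.
    by rewrite -in_take //; exact: mem_take hp.
  have -> : (carry T a ys (index q ys) == p) = false.
    by apply/negbTE; apply: contraTneq huk => ->; rewrite /= hp.
  by rewrite andbF; apply/negbTE; rewrite -leqNgt; lia.
rewrite -pk eqxx andbT.
have hpz : index q ys <= index p (cstep T a ys).
  apply: leq_index_notin; first by rewrite hsz; lia.
  by move: huk; rewrite -pk => /andP[].
have qp : q != p.
  by apply: contraTneq hpq => qp; rewrite -qp /= aq ltnn.
case: ifP hnz => _ hnz.
  have iq : index q (cstep T a ys) = index q ys by rewrite -{1}hnz index_uniq // hsz; lia.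
  rewrite iq ltn_neqAle hpz andbT; apply: contraNneq qp => hi.
  have : p \in cstep T a ys by rewrite -index_mem -hi hsz; lia.
  by move/(nth_index 0); rewrite -hi hnz => ->.
have ip : index p (cstep T a ys) = index q ys by rewrite pk -{1}hnz index_uniq // hsz; lia.
by apply/negbTE; rewrite -leqNgt ip.
Qed.

Definition colT (m : nat) (P : pdream) (c : nat) : seq tile :=
  mkseq (fun r => tile_at P r c) (m - c).

Definition cols (m : nat) (P : pdream) : seq (seq tile) :=
  [seq colT m P c | c <- iota 0 m].

Lemma count_le1 (T : eqType) (f : pred T) (t : seq T) : uniq t ->
  {in t &, forall x y, f x -> f y -> x = y} -> count f t <= 1.
Proof.
move=> hu h; rewrite leqNgt; apply/negP; rewrite -size_filter.
have := filter_uniq f hu; have hm x : x \in [seq x <- t | f x] -> f x /\ x \in t.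
  by rewrite mem_filter => /andP.
case: [seq _ <- _ | _] hm => [|x [|y u]] // hm /=.
have [fx xt] := hm x (mem_head _ _).
have [fy yt] : f y /\ y \in t by apply: hm; rewrite !inE eqxx orbT.
by rewrite (h x y) // mem_head.
Qed.

Lemma count_ge2 (T : eqType) (f : pred T) (t : seq T) x y :
  x \in t -> y \in t -> f x -> f y -> x != y -> 1 < count f t.
Proof.
move=> xt yt fx fy hxy; rewrite -size_filter.
apply: (@uniq_leq_size _ [:: x; y]); first by rewrite /= inE hxy.
by move=> z; rewrite !inE mem_filter => /orP[/eqP->|/eqP->]; rewrite ?fx ?fy.
Qed.

Section Trace.

Variables (P : pdream) (s : seq nat).
Local Notation m := (size s).

(** The labels on the left edge of column [c], from top to bottom; [left r c] and [top r c] are the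
    labels on the left and the top edge of tile [(r, c)]. *)
Definition lefts (c : nat) : seq nat :=
  run [seq colT (size s) P c' | c' <- iota c (size s - c)] (drop c s).
Definition left (r c : nat) : nat := nth 0 (lefts c) r.
Definition top (r c : nat) : nat :=
  carry (colT (size s) P c) (nth 0 s c) (lefts c.+1) r.

Lemma leftsE c : c < m -> lefts c = cstep (colT m P c) (nth 0 s c) (lefts c.+1).
Proof.
move=> hc; rewrite /lefts (drop_nth 0) //.
by have -> : size s - c = (size s - c.+1).+1 by lia.
Qed.

Lemma perm_lefts c : perm_eq (lefts c) (drop c s).
Proof. by apply: perm_run; rewrite size_map size_iota size_drop. Qed.

Lemma size_lefts c : size (lefts c) = m - c.
Proof. by rewrite (perm_size (perm_lefts c)) size_drop. Qed.

Lemma size_colT c : size (colT m P c) = m - c.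
Proof. exact: size_mkseq. Qed.

Lemma nth_colT r c : r + c < m -> nth Cross (colT m P c) r = tile_at P r c.
Proof. by move=> h; rewrite nth_mkseq //; lia. Qed.

Lemma top0 c : top 0 c = nth 0 s c.
Proof. by rewrite /top; case: (colT _ _ _). Qed.

Lemma topS r c : r.+1 + c < m ->
  top r.+1 c = if is_cross (tile_at P r c) then top r c else left r c.+1.
Proof.
move=> h; rewrite /top carryS ?nth_colT ?size_lefts ?size_colT //; lia.
Qed.

Lemma lefts0 : lefts 0 = run (cols m P) s.
Proof. by rewrite /lefts subn0 drop0. Qed.

Lemma okrun_cols :
  okrun (cols m P) s <->
  (forall c, c < m -> okcol (colT m P c) (nth 0 s c) (lefts c.+1)).
Proof.
have key n : forall c, c + n = m ->
    okrun [seq colT m P c' | c' <- iota c n] (drop c s) <->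
    (forall c', c <= c' -> c' < m -> okcol (colT m P c') (nth 0 s c') (lefts c'.+1)).
  elim: n => [|n IH] c hc.
    by rewrite drop_oversize; [split=> // _ c'; lia|lia].
  rewrite (drop_nth 0) /=; last by lia.
  have hcS : c.+1 + n = m by lia.
  have -> : run [seq colT m P c' | c' <- iota c.+1 n] (drop c.+1 s) = lefts c.+1.
    by rewrite /lefts (_ : n = m - c.+1) //; lia.
  have [IH1 IH2] := IH _ hcS; split=> [/andP[h1 h2] c'|h].
    rewrite leq_eqVlt => /orP[/eqP<-//|h3]; exact: IH1.
  by apply/andP; split; [apply: h; lia|apply: IH2 => c' h1; apply: h; lia].
have := key m 0 (add0n _); rewrite drop0 => -[h1 h2]; split=> h; first by move=> c; apply: h1.
by apply: h2 => c _; apply: h.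
Qed.

Lemma okrun_legal :
  okrun (cols m P) s <->
  (forall r c, r + c < m ->
     if r.+1 + c < m then is_true (tileok (tile_at P r c) (top r c) (left r c.+1))
     else tile_at P r c = Bump).
Proof.
split=> [/okrun_cols h r c hrc|h].
  have hc : c < m by lia.
  case/okcolP: (h c hc); rewrite size_lefts => h1 h2 h3.
  case: ifP => h4.
    by have := h3 r; rewrite nth_colT //; apply; lia.
  by rewrite -h2 nth_colT; [congr tile_at; lia|lia].
apply/okrun_cols => c hc; apply/okcolP; rewrite size_lefts size_colT; split; first by lia.
  by have := h (m - c.+1) c; rewrite nth_colT; [case: ifP; [lia|move=> _; apply; lia]|lia].
move=> r hr; have := h r c; rewrite nth_colT; last by lia.
have hrc : r.+1 + c < m by lia.
by rewrite hrc; apply; lia.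
Qed.

Lemma mem_left r c : r + c < m -> left r c \in lefts c.
Proof. by move=> h; rewrite mem_nth // size_lefts; lia. Qed.

Lemma mem_top r c : r + c < m -> top r c \in nth 0 s c :: take r (lefts c.+1).
Proof. by move=> h; rewrite carry_mem ?size_lefts ?size_colT; lia. Qed.

Lemma mem_s x c : x \in lefts c -> exists2 k, k < m & x = nth 0 s k.
Proof.
by rewrite (perm_mem (perm_lefts c)) => /mem_drop /(nthP 0)[k h <-]; exists k.
Qed.

Lemma top_s r c : r + c < m -> exists2 k, k < m & top r c = nth 0 s k.
Proof.
move=> h; have := mem_top h; rewrite inE => /orP[/eqP->|/mem_take/mem_s //].
by exists c => //; lia.
Qed.

(** * The relative order of two pipes *)

Definition crossing (r c p q : nat) : bool :=
  [&& r.+1 + c < size s, is_cross (tile_at P r c), top r c == p & left r c.+1 == q].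

(** Meant for [p < q]. The pipe [p] starts further left and enters above [q], so finding [q] above
    [p] is the trace of an earlier crossing. *)
Definition inverted (c p q : nat) : bool :=
  (p \in lefts c) && (index q (lefts c) < index p (lefts c)).

Definition legal : Prop :=
  forall r c, r.+1 + c < m -> is_cross (tile_at P r c) -> top r c < left r c.+1.

Hypothesis sorted_s : sorted ltn s.

Lemma uniq_s : uniq s.
Proof. by apply: sorted_uniq sorted_s; [exact: ltn_trans | exact: ltnn]. Qed.

Lemma uniq_lefts c : uniq (lefts c).
Proof. by rewrite (perm_uniq (perm_lefts c)) drop_uniq // uniq_s. Qed.

Lemma uniq_top_lefts c : c < m -> uniq (nth 0 s c :: lefts c.+1).
Proof.
move=> hc; have := drop_uniq c uniq_s; rewrite (drop_nth 0) //=.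
by rewrite (perm_mem (perm_lefts _)) (perm_uniq (perm_lefts _)).
Qed.

Lemma mem_lefts k c : k < m -> (nth 0 s k \in lefts c) = (c <= k).
Proof.
move=> hk; rewrite (perm_mem (perm_lefts c)); apply/idP/idP => [h|h].
  rewrite leqNgt; apply/negP => hkc.
  have h1 : nth 0 s k \in take c s.
    by rewrite -(nth_take 0 hkc) mem_nth // size_take; case: ifP.
  have := uniq_s; rewrite -{1}(cat_take_drop c s) cat_uniq => /and3P[_ /hasP h2 _].
  by apply: h2; exists (nth 0 s k).
have <- : nth 0 (drop c s) (k - c) = nth 0 s k by rewrite nth_drop subnKC.
by apply: mem_nth; rewrite size_drop ltn_sub2r // (leq_ltn_trans h hk).
Qed.

Lemma index_left r c : r + c < m -> index (left r c) (lefts c) = r.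
Proof. by move=> h; rewrite index_uniq ?uniq_lefts // size_lefts; lia. Qed.

Lemma top_neq_left r c : r.+1 + c < m -> top r c != left r c.+1.
Proof.
move=> h; have h' : r + c < m by lia.
apply/eqP => e; have := mem_top h'; rewrite e inE.
have hl := mem_left (_ : r + c.+1 < m); rewrite in_take ?hl ?index_left ?ltnn ?orbF; try lia.
have hc : c < m by lia.
have := uniq_top_lefts hc; rewrite /= => /andP[h1 _] /eqP h2.
by move: h1; rewrite -h2 hl //; lia.
Qed.

Lemma index_lefts_le x c1 c2 : x \in lefts c1 -> c2 <= c1 ->
  index x (lefts c1) <= index x (lefts c2).
Proof.
move=> hx; elim: c1 c2 hx => [|c1 IH] c2 hx; first by case: c2.
rewrite leq_eqVlt => /orP[/eqP->//|hc]; apply: leq_trans (IH _ _ _); last by lia.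
- have hc1 : c1 < m.
    by rewrite ltnNge; apply/negP => h; move: hx; rewrite -index_mem size_lefts; lia.
  rewrite (leftsE hc1); apply: index_cstep => //; first exact: uniq_top_lefts.
  by rewrite size_lefts size_colT; lia.
have hc1 : c1 < m.
  by rewrite ltnNge; apply/negP => h; move: hx; rewrite -index_mem size_lefts; lia.
by rewrite (leftsE hc1) (perm_mem (perm_cstep _ _ _)) inE hx orbT.
Qed.

Lemma crossingP r c p q : crossing r c p q =
  [&& c < m, crosses (colT m P c) (nth 0 s c) (lefts c.+1) p q & r == index q (lefts c.+1)].
Proof.
rewrite /crossing /crosses; apply/and4P/and3P => [[h1 h2 /eqP h3 /eqP h4]|[h1 /and3P[h2 h3 h4] /eqP h5]].
  have hr : index q (lefts c.+1) = r by rewrite -h4 index_left //; lia.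
  split; [lia| |by rewrite hr].
  rewrite hr nth_colT; last by lia.
  move: h3; rewrite /top => ->; rewrite -{1}h4 mem_left; last by lia.
  by rewrite eqxx andbT.
have hr : r < size (lefts c.+1) by rewrite h5 index_mem.
rewrite size_lefts in hr.
split; first by lia.
- by move: h3; rewrite -h5 nth_colT //; lia.
- by rewrite /top h5.
by rewrite /left h5 nth_index.
Qed.

Lemma inverted_step c kp kq (p := nth 0 s kp) (q := nth 0 s kq)
    (X := crosses (colT m P c) (nth 0 s c) (lefts c.+1)) :
  kp < kq -> kq < m -> c <= kp ->
  if inverted c.+1 p q then inverted c p q = ~~ X q p /\ X p q = false
  else inverted c p q = X p q /\ X q p = false.
Proof.
move=> hpq hq hc.
have hp : kp < m by lia.
have hcm : c < m by lia.
have npq : (p == q) = false by rewrite nth_uniq ?uniq_s // ltn_eqF.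
have hpc : p \in lefts c by rewrite mem_lefts.
have hqc : q \in lefts c.+1 by rewrite mem_lefts //; lia.
have hu := uniq_top_lefts hcm.
have hs : size (lefts c.+1) < size (colT m P c) by rewrite size_lefts size_colT; lia.
have aq : (nth 0 s c == q) = false by rewrite nth_uniq ?uniq_s //; lia.
rewrite [inverted c _ _]/inverted hpc /= leftsE //.
case: ifP => [/andP[hpc1 hlt]|].
  have ap : (nth 0 s c == p) = false.
    by apply/negbTE/negP => /eqP e; move: hu; rewrite e /= hpc1.
  have [||h1 h2] := crosses_order hu hs (p := q) (q := p).
  - by rewrite inE hpc1 orbT.
  - by rewrite /= ap aq.
  split=> //; rewrite /X -h1 -leqNgt ltn_neqAle; case: leqP => // h3; rewrite ?andbF ?andbT //.
  apply: contraFneq npq => hi.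
  have hqz : q \in cstep (colT m P c) (nth 0 s c) (lefts c.+1).
    by rewrite (perm_mem (perm_cstep _ _ _)) inE hqc orbT.
  rewrite -(nth_index 0 hqz) hi nth_index // (perm_mem (perm_cstep _ _ _)) inE hpc1 orbT //.
move=> hinv; apply: crosses_order => //; first by rewrite inE hqc orbT.
have [ap|ap] := eqVneq (nth 0 s c) p; first by rewrite /= ap eqxx npq.
rewrite /= (negbTE ap) aq ltnS.
have hpc1 : p \in lefts c.+1.
  rewrite mem_lefts //; move: ap; rewrite nth_uniq ?uniq_s //; lia.
move: hinv; rewrite /inverted hpc1 /= => /negbT; rewrite -leqNgt ltn_neqAle => ->.
rewrite andbT; apply: contraFneq npq => hi.
by rewrite -(nth_index 0 hpc1) hi nth_index.
Qed.

(** Going to the right the inversion has to end, at the latest where [p] has not entered yet. The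
    column in which it ends contains the crossing. *)
Lemma inverted_crossing c kp kq : kp < kq -> kq < m ->
  inverted c (nth 0 s kp) (nth 0 s kq) ->
  exists r c', c <= c' /\ crossing r c' (nth 0 s kp) (nth 0 s kq).
Proof.
move=> hpq hq; have [n] := ubnP (m - c); elim: n c => // n IH c hn hinv.
have hc : c <= kp by case/andP: hinv; rewrite mem_lefts //; lia.
have := inverted_step hpq hq hc; case: ifP => [hinv' _|_ [h _]].
  have [||r [c' [h1 h2]]] := IH c.+1 => //; first by lia.
  by exists r, c'; split=> //; lia.
exists (index (nth 0 s kq) (lefts c.+1)), c; split=> //.
by rewrite crossingP -h hinv eqxx !andbT; lia.
Qed.

Lemma crossing_le r c kp q : kp < m -> crossing r c (nth 0 s kp) q -> c <= kp.
Proof.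
move=> hp /and4P[h1 h2 /eqP h3 h4].
have hrc : r + c < m by lia.
have hcm : c < m by lia.
have := mem_top hrc; rewrite h3 inE nth_uniq ?uniq_s //.
by case/orP => [/eqP->//|/mem_take]; rewrite mem_lefts //; lia.
Qed.

Lemma crossing_le' r c p kq : kq < m -> crossing r c p (nth 0 s kq) -> c < kq.
Proof.
move=> hp /and4P[h1 h2 h3 /eqP h4].
by rewrite -(mem_lefts _ hp) -h4 mem_left //; lia.
Qed.

Lemma s_lt k l : k < m -> l < m -> (nth 0 s k < nth 0 s l) = (k < l).
Proof.
move=> hk hl; apply/idP/idP => h.
  rewrite ltnNge; apply/negP; rewrite leq_eqVlt => /orP[/eqP e|h'].
    by rewrite e ltnn in h.
  by have := sorted_ltn_nth ltn_trans 0 sorted_s l k hl hk h'; lia.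
by have := sorted_ltn_nth ltn_trans 0 sorted_s k l hk hl h.
Qed.

Lemma legal_crossing r c k l : legal -> k < m -> l < m ->
  crossing r c (nth 0 s k) (nth 0 s l) -> k < l.
Proof. by move=> hl hk hl' /and4P[h1 h2 /eqP h3 /eqP h4]; rewrite -s_lt // -h3 -h4 hl. Qed.

(** Undoing an inversion would take a crossing with the larger label vertical, which is illegal. *)
Lemma legal_inverted c c' kp kq : legal -> kp < kq -> kq < m -> c' <= c ->
  inverted c (nth 0 s kp) (nth 0 s kq) -> inverted c' (nth 0 s kp) (nth 0 s kq).
Proof.
move=> hl hpq hq hc hinv.
elim: c hc hinv => [|c IH] hc hinv; first by move: hc; rewrite leqn0 => /eqP->.
move: hc; rewrite leq_eqVlt => /orP[/eqP->//|hc].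
have hck : c < kp by case/andP: hinv; rewrite mem_lefts //; lia.
have := inverted_step hpq hq (ltnW hck); rewrite hinv => -[h _]; apply: IH => //.
rewrite h; apply/negP => h'.
have := @legal_crossing (index (nth 0 s kp) (lefts c.+1)) c kq kp hl hq (ltn_trans hpq hq).
rewrite crossingP h' eqxx andbT (_ : c < m); last by lia.
by move/(_ isT); lia.
Qed.

Lemma crossing_inverted r c kp kq : kp < kq -> kq < m ->
  crossing r c (nth 0 s kp) (nth 0 s kq) ->
  ~~ inverted c.+1 (nth 0 s kp) (nth 0 s kq) /\ inverted c (nth 0 s kp) (nth 0 s kq).
Proof.
move=> hpq hq hx; have hc := crossing_le (ltn_trans hpq hq) hx.
move: hx; rewrite crossingP => /and3P[_ hx _].
by have := inverted_step hpq hq hc; rewrite hx; case: ifP => _ [].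
Qed.

(** The crossing further right inverts the two pipes, and they stay inverted; the one further left
    would need them in their initial order. *)
Lemma legal_crossing_unique r c r' c' kp kq : legal -> kp < kq -> kq < m ->
  crossing r c (nth 0 s kp) (nth 0 s kq) -> crossing r' c' (nth 0 s kp) (nth 0 s kq) ->
  r = r' /\ c = c'.
Proof.
move=> hl hpq hq.
have key r1 c1 r2 c2 : c2 < c1 -> crossing r1 c1 (nth 0 s kp) (nth 0 s kq) ->
    crossing r2 c2 (nth 0 s kp) (nth 0 s kq) -> False.
  move=> hc /(crossing_inverted hpq hq)[_ h1] /(crossing_inverted hpq hq)[/negP h2 _].
  by apply: h2; apply: legal_inverted h1.
move=> h1 h2; have ecc : c = c'.
  by case: (ltngtP c c') => // h; [case: (key _ _ _ _ h h2 h1)|case: (key _ _ _ _ h h1 h2)].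
split=> //; move: h1 h2; rewrite -ecc !crossingP.
by case/and3P => _ _ /eqP-> /and3P[_ _ /eqP->].
Qed.

(** * Following a single pipe *)

Hypothesis sizeP : size P = m.
Hypothesis anti : forall r c, r + c = m.-1 -> r < m -> is_bumping (tile_at P r c).

Lemma leftE r c : r + c < m ->
  left r c = if is_cross (tile_at P r c) then left r c.+1 else top r c.
Proof.
move=> h; rewrite /left leftsE; last by lia.
rewrite nth_cstep ?size_lefts ?size_colT ?nth_colT //; try lia.
case: ltnP => //= h2; rewrite ifF //.
by apply/negbTE; apply: anti; lia.
Qed.

Lemma topS_cross r c : r + c < m -> is_cross (tile_at P r c) -> r.+1 + c < m.
Proof.
move=> h hc; rewrite ltn_neqAle h andbT; apply/eqP => e.
have /negP[] : is_bumping (tile_at P r c) by apply: anti; lia.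
by [].
Qed.

(* [vis x r c kd]: the pipe labelled [x] traverses tile [(r, c)] in the way [kd]. *)
Definition vis (x r c : nat) (kd : kind) : bool :=
  match kd with
  | Vert => [&& r + c < size s, is_cross (tile_at P r c) & top r c == x]
  | UL => [&& r + c < size s, ~~ is_cross (tile_at P r c) & top r c == x]
  | Horiz => [&& r.+1 + c < size s, is_cross (tile_at P r c) & left r c.+1 == x]
  | LR => [&& r.+1 + c < size s, ~~ is_cross (tile_at P r c) & left r c.+1 == x]
  end.

Definition enters (x r c : nat) (down : bool) : bool :=
  if down then (r + c < size s) && (top r c == x)
  else (r.+1 + c < size s) && (left r c.+1 == x).

(** Row minus column increases strictly along a pipe; the inequality is written without
    subtraction. *)
Definition along (u v : nat * nat * kind) : bool := u.1.1 + v.1.2 < v.1.1 + u.1.2.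

(** Each step goes down or left and lowers [m - r + c], so the fuel does not run out. The bumps on
    the antidiagonal keep the pipe inside the staircase. *)
Lemma trace_sound fuel r c down x : m - r + c <= fuel -> enters x r c down ->
  let vs := (trace P fuel r c down).1 in
  [/\ forall y : nat * nat * kind, y \in vs -> [/\ vis x y.1.1 y.1.2 y.2, r <= y.1.1 & y.1.2 <= c],
      pairwise along vs &
      (trace P fuel r c down).2 < m /\ left (trace P fuel r c down).2 0 = x].
Proof.
have cons_ok y0 vs r' c' : vis x y0.1.1 y0.1.2 y0.2 -> y0.1.1 <= r' -> c' <= y0.1.2 ->
    y0.1.1 + c' < r' + y0.1.2 ->
    (forall y : nat * nat * kind, y \in vs -> [/\ vis x y.1.1 y.1.2 y.2, r' <= y.1.1 & y.1.2 <= c']) ->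
    pairwise along vs ->
    (forall y : nat * nat * kind, y \in y0 :: vs -> [/\ vis x y.1.1 y.1.2 y.2, y0.1.1 <= y.1.1 & y.1.2 <= y0.1.2]) /\
    pairwise along (y0 :: vs).
  move=> hv hr hc hlt h hp; split=> [y|].
    rewrite inE => /orP[/eqP->//|/h[h1 h2 h3]]; split=> //; lia.
  by rewrite /= hp andbT; apply/allP => y /h[_ h2 h3]; rewrite /along; lia.
elim: fuel r c down => [|fuel IH] r c down hf.
  by rewrite /enters; case: down => /andP[]; lia.
case: down => /=; move=> /andP[hrc /eqP hx].
- case ht: (is_cross (tile_at P r c)).
    have hS := topS_cross hrc ht.
    have /= := IH r.+1 c true; case: (trace P fuel r.+1 c true) => vs e /= [||h1 h2 h3].
    + lia.
    + by rewrite /enters hS topS // ht hx eqxx.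
    have [||||h4 h5] := @cons_ok (r, c, Vert) vs r.+1 c _ _ _ _ h1 h2; rewrite /= ?hrc ?ht ?hx ?eqxx //=; lia.
  case: c hf hrc hx ht => [|c] hf hrc hx ht /=.
    split=> // [y|]; first by rewrite inE => /eqP-> /=; rewrite hrc ht hx eqxx.
    by split; [lia|rewrite leftE // ht].
  have /= := IH r c false; case: (trace P fuel r c false) => vs e /= [||h1 h2 h3].
  + lia.
  + rewrite /enters leftE // ht hx eqxx; lia.
  have [||||h4 h5] := @cons_ok (r, c.+1, UL) vs r c _ _ _ _ h1 h2; rewrite /= ?hrc ?ht ?hx ?eqxx //=; lia.
case ht: (is_cross (tile_at P r c)).
  case: c hf hrc hx ht => [|c] hf hrc hx ht /=.
    split=> // [y|]; first by rewrite inE => /eqP-> /=; rewrite hrc ht hx eqxx.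
    by split; [lia|rewrite leftE ?ht //; lia].
  have /= := IH r c false; case: (trace P fuel r c false) => vs e /= [||h1 h2 h3].
  + lia.
  + rewrite /enters leftE ?ht ?hx ?eqxx; lia.
  have [||||h4 h5] := @cons_ok (r, c.+1, Horiz) vs r c _ _ _ _ h1 h2; rewrite /= ?hrc ?ht ?hx ?eqxx //=; lia.
have /= := IH r.+1 c true; case: (trace P fuel r.+1 c true) => vs e /= [||h1 h2 h3].
+ lia.
+ by rewrite /enters hrc topS // ht hx eqxx.
have [||||h4 h5] := @cons_ok (r, c, LR) vs r.+1 c _ _ _ _ h1 h2; rewrite /= ?hrc ?ht ?hx ?eqxx //=; lia.
Qed.

Definition visit_of (r c : nat) (down : bool) : nat * nat * kind :=
  (r, c, if down then if is_cross (tile_at P r c) then Vert else UL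
         else if is_cross (tile_at P r c) then Horiz else LR).

Definition next_visit (y : nat * nat * kind) : option (nat * nat * kind) :=
  match y.2 with
  | Vert | LR => Some (visit_of y.1.1.+1 y.1.2 true)
  | Horiz | UL => if y.1.2 is c.+1 then Some (visit_of y.1.1 c false) else None
  end.

Lemma trace_head fuel r c down : 0 < fuel ->
  visit_of r c down \in (trace P fuel r c down).1.
Proof.
case: fuel => //= fuel _; rewrite /visit_of; case: down; case: ifP => _.
- by case: (trace _ _ _ _ _) => vs e; rewrite mem_head.
- by case: c => [|c]; rewrite ?mem_head //; case: (trace _ _ _ _ _) => vs e; rewrite mem_head.
- by case: c => [|c]; rewrite ?mem_head //; case: (trace _ _ _ _ _) => vs e; rewrite mem_head.
by case: (trace _ _ _ _ _) => vs e; rewrite mem_head.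
Qed.

Lemma trace_next fuel r c down x y z : m - r + c <= fuel -> enters x r c down ->
  y \in (trace P fuel r c down).1 -> next_visit y = Some z ->
  z \in (trace P fuel r c down).1.
Proof.
have cons_ok y0 z0 vs : (next_visit y0 = Some z0 -> z0 \in vs) ->
    (y \in vs -> next_visit y = Some z -> z \in vs) ->
    y0 = y0 -> next_visit y0 = Some z0 ->
    y \in y0 :: vs -> next_visit y = Some z -> z \in y0 :: vs.
  move=> h1 h2 _ h3; rewrite !inE => /orP[/eqP->|h].
    by rewrite h3 => -[<-]; rewrite h1 ?orbT.
  by move=> h4; rewrite h2 ?orbT.
elim: fuel r c down => [|fuel IH] r c down hf.
  by rewrite /enters; case: down => /andP[]; lia.
case: down => /=; move=> /andP[hrc /eqP hx].
- case ht: (is_cross (tile_at P r c)).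
    have hS := topS_cross hrc ht.
    have hf' : m - r.+1 + c <= fuel by lia.
    have he : enters x r.+1 c true by rewrite /enters hS topS // ht hx eqxx.
    have := IH _ _ _ hf' he; have := @trace_head fuel r.+1 c true.
    case: (trace P fuel r.+1 c true) => vs e /= hh h.
    by apply: (cons_ok _ (visit_of r.+1 c true)) => // _; apply: hh; lia.
  case: c hf hrc hx ht => [|c] hf hrc hx ht /=.
    by rewrite inE => /eqP->.
  have hf' : m - r + c <= fuel by lia.
  have he : enters x r c false by rewrite /enters leftE // ht hx eqxx; lia.
  have := IH _ _ _ hf' he; have := @trace_head fuel r c false.
  case: (trace P fuel r c false) => vs e /= hh h.
  by apply: (cons_ok _ (visit_of r c false)) => // _; apply: hh; lia.
case ht: (is_cross (tile_at P r c)).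
  case: c hf hrc hx ht => [|c] hf hrc hx ht /=.
    by rewrite inE => /eqP->.
  have hf' : m - r + c <= fuel by lia.
  have he : enters x r c false by rewrite /enters leftE ?ht ?hx ?eqxx; lia.
  have := IH _ _ _ hf' he; have := @trace_head fuel r c false.
  case: (trace P fuel r c false) => vs e /= hh h.
  by apply: (cons_ok _ (visit_of r c false)) => // _; apply: hh; lia.
have hf' : m - r.+1 + c <= fuel by lia.
have he : enters x r.+1 c true by rewrite /enters hrc topS // ht hx eqxx.
have := IH _ _ _ hf' he; have := @trace_head fuel r.+1 c true.
case: (trace P fuel r.+1 c true) => vs e /= hh h.
by apply: (cons_ok _ (visit_of r.+1 c true)) => // _; apply: hh; lia.
Qed.

Lemma enters_start k : k < m -> enters (nth 0 s k) 0 k true.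
Proof. by move=> hk; rewrite /enters /= hk top0 eqxx. Qed.

Lemma fuel_start k : k < m -> m - 0 + k <= (2 * size P).+1.
Proof. by rewrite sizeP; lia. Qed.

(** The label is followed backwards, to the tile above or to the right, until the top row is
    reached. There the labels are the distinct entries of [s], so the column is [k]; from there on
    the trace contains the successor of each of its visits. *)
Lemma enters_visit k r c down : k < m -> enters (nth 0 s k) r c down ->
  visit_of r c down \in pipe_visits P k.
Proof.
move=> hk; have hnext := trace_next (fuel_start hk) (enters_start hk).
have [n] := ubnP ((r + (m - c)).*2 + ~~ down).
elim: n r c down => // n IH r c down hn.
case: down hn => /= hn /andP[hrc /eqP hx].
  case: r hn hrc hx => [|r] hn hrc hx.
    have -> : c = k.
      by apply/eqP; rewrite -(nth_uniq 0 hrc hk uniq_s) -hx top0.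
    exact: trace_head.
  move: hx; rewrite topS //; case ht: (is_cross _) => hx.
    have hv : visit_of r c true \in pipe_visits P k.
      by apply: IH; [lia|rewrite /enters hx eqxx; lia].
    by apply: (hnext _ _ hv); rewrite /visit_of ht.
  have hv : visit_of r c false \in pipe_visits P k.
    by apply: IH; [rewrite /=; lia|rewrite /enters hx eqxx; lia].
  by apply: (hnext _ _ hv); rewrite /visit_of ht.
move: hx; rewrite leftE; last by lia.
case ht: (is_cross _) => hx.
  have hv : visit_of r c.+1 false \in pipe_visits P k.
    have hS : r + c.+1 < m by lia.
    apply: IH; first by rewrite /=; lia.
    by rewrite /enters hx eqxx (topS_cross hS ht).
  by apply: (hnext _ _ hv); rewrite /visit_of ht.
have hv : visit_of r c.+1 true \in pipe_visits P k.
  by apply: IH; [rewrite /=; lia|rewrite /enters hx eqxx; lia].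
by apply: (hnext _ _ hv); rewrite /visit_of ht.
Qed.

Lemma mem_pipe_visits k r c kd : k < m ->
  ((r, c, kd) \in pipe_visits P k) = vis (nth 0 s k) r c kd.
Proof.
move=> hk; apply/idP/idP => [h|].
  by have [/(_ _ h)[]] := trace_sound (fuel_start hk) (enters_start hk).
case: kd => /and3P[h1 h2 h3].
- have := @enters_visit k r c true hk; rewrite /enters h1 h3 /visit_of h2; exact.
- have := @enters_visit k r c false hk; rewrite /enters h1 h3 /visit_of h2; exact.
- have := @enters_visit k r c true hk; rewrite /enters h1 h3 /visit_of (negbTE h2); exact.
have := @enters_visit k r c false hk; rewrite /enters h1 h3 /visit_of (negbTE h2); exact.
Qed.

Lemma pipe_exitP k : k < m ->
  pipe_exit P k < m /\ left (pipe_exit P k) 0 = nth 0 s k.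
Proof. by move=> hk; have [] := trace_sound (fuel_start hk) (enters_start hk). Qed.

Lemma pairwise_pipe_visits k : k < m -> pairwise along (pipe_visits P k).
Proof. by move=> hk; have [] := trace_sound (fuel_start hk) (enters_start hk). Qed.

Definition at_cell (x r c : nat) : bool :=
  (r + c < size s) && ((top r c == x) || (r.+1 + c < size s) && (left r c.+1 == x)).

Lemma visits_cellP k r c : k < m -> visits_cell P k r c = at_cell (nth 0 s k) r c.
Proof.
move=> hk; apply/hasP/idP => [[[[r' c'] kd] hv /andP[/= /eqP er /eqP ec]]|].
  move: hv; rewrite er ec mem_pipe_visits // /at_cell; case: kd => /and3P[h1 h2 h3];
    rewrite h3 h1 ?orbT ?andbT //; lia.
case/andP => hrc /orP[h|/andP[h' h]].
  exists (visit_of r c true); last by rewrite /= !eqxx.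
  by apply: enters_visit => //; rewrite /enters hrc h.
exists (visit_of r c false); last by rewrite /= !eqxx.
by apply: enters_visit => //; rewrite /enters h' h.
Qed.

Lemma uniq_pipe_visits k : k < m -> uniq (pipe_visits P k).
Proof.
move=> hk; rewrite uniq_pairwise; apply: sub_pairwise (pairwise_pipe_visits hk) => u v.
by apply: contraTneq => ->; rewrite /along ltnn.
Qed.

(** * Reducedness and markability in terms of labels *)

Lemma cross_visit k l r c kd : k < m -> l < m -> k != l ->
  (r, c, kd) \in pipe_visits P k -> (kd == Vert) || (kd == Horiz) ->
  visits_cell P l r c ->
  (kd = Vert /\ crossing r c (nth 0 s k) (nth 0 s l)) \/
  (kd = Horiz /\ crossing r c (nth 0 s l) (nth 0 s k)).
Proof.
move=> hk hl hkl; rewrite mem_pipe_visits // visits_cellP // => hv hkd /andP[hrc ho].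
have hn : (nth 0 s k == nth 0 s l) = false by rewrite nth_uniq ?uniq_s // (negbTE hkl).
case: kd hkd hv => // _ /and3P[h1 h2 /eqP h3]; [left|right]; split=> //; rewrite /crossing h2 h3 eqxx /=.
  by move: ho; rewrite h3 hn /= => ->.
by move: ho; rewrite h3 hn andbF orbF h1 => ->.
Qed.

Lemma crossing_sym_visit k l r c kd : k < m -> l < m ->
  (kd = Vert /\ crossing r c (nth 0 s k) (nth 0 s l)) \/
  (kd = Horiz /\ crossing r c (nth 0 s l) (nth 0 s k)) ->
  (r, c, kd) \in pipe_visits P k /\ visits_cell P l r c.
Proof.
move=> hk hl; rewrite mem_pipe_visits // visits_cellP // /at_cell.
case=> -[-> /and4P[h1 h2 h3 h4]]; rewrite /vis h1 h2 h3 h4 /= ?orbT ?andbT; split=> //; lia.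
Qed.

Lemma ncross_legal k l : legal -> k < m -> l < m -> k != l -> ncross P k l <= 1.
Proof.
move=> hlg hk hl hkl; apply: count_le1; first exact: uniq_pipe_visits.
move=> [[r c] kd] [[r' c'] kd'] h1 h2 /andP[/= h3 h4] /andP[/= h5 h6].
have := cross_visit hk hl hkl h1 h3 h4; have := cross_visit hk hl hkl h2 h5 h6.
case=> -[-> hx'] [] [-> hx].
- by have [->->] := legal_crossing_unique hlg (legal_crossing hlg hk hl hx) hl hx hx'.
- by have := legal_crossing hlg hk hl hx'; have := legal_crossing hlg hl hk hx; lia.
- by have := legal_crossing hlg hl hk hx'; have := legal_crossing hlg hk hl hx; lia.
by have [->->] := legal_crossing_unique hlg (legal_crossing hlg hl hk hx) hk hx hx'.
Qed.

(** At an illegal crossing the two pipes are already inverted on its right, so they have crossed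
    once before. *)
Lemma ncross_le1_legal :
  (forall k l, k < m -> l < m -> k != l -> ncross P k l <= 1) -> legal.
Proof.
move=> hn r c hrc ht; have hrc' : r + c < m by lia.
have [kq hq eq] := top_s hrc'.
have /mem_s [kp hp ep] : left r c.+1 \in lefts c.+1 by apply: mem_left; lia.
have hne := top_neq_left hrc; rewrite eq ep in hne *.
have hx : crossing r c (nth 0 s kq) (nth 0 s kp) by rewrite /crossing hrc ht eq ep !eqxx.
rewrite s_lt //; rewrite nth_uniq ?uniq_s // in hne.
rewrite ltnNge leq_eqVlt eq_sym (negbTE hne) /=; apply/negP => hpq.
have hc : c <= kp by apply: ltnW; apply: crossing_le' hx.
have := inverted_step hpq hq hc; case: ifP => [hinv _|_ [_]]; last first.
  by move: hx; rewrite crossingP => /and3P[_ -> _].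
have [r' [c' [hc' hx']]] := inverted_crossing hpq hq hinv.
have hkl : kp != kq by lia.
(* The smaller pipe is vertical at one crossing and horizontal at the other, hence these are two
   different visits. *)
have [h1 h2] := @crossing_sym_visit kp kq r' c' Vert hp hq (or_introl (conj erefl hx')).
have [h3 h4] := @crossing_sym_visit kp kq r c Horiz hp hq (or_intror (conj erefl hx)).
have := hn _ _ hp hq hkl; rewrite leqNgt => /negP; apply.
by apply: (count_ge2 h1 h3); rewrite ?h2 ?h4 // -pair_eqE /= -pair_eqE /= andbF.
Qed.

(** Two pipes meeting at a bump have crossed before exactly if the larger label is the upper-left
    one. As pipes only descend, that earlier crossing lies in a column further right and in a row
    strictly above. *)
Lemma markableP r c : legal -> r + c < m -> ~~ is_cross (tile_at P r c) ->
  markable m P r c <-> r.+1 + c < m /\ left r c.+1 < top r c.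
Proof.
move=> hlg hrc htc; split=> [[p [q [hp hq]]]|[hrc1 hlt]].
  rewrite !mem_pipe_visits // => /and3P[_ hb /eqP hpt] /and3P[hrc1 _ /eqP hql].
  case=> [r1 [c1 [hr1 hrc1' hx]]]; rewrite !visits_cellP // => /andP[_ vp] /andP[_ vq].
  split=> //; have hne := top_neq_left hrc1.
  rewrite hpt hql in hne *; rewrite nth_uniq ?uniq_s // in hne.
  rewrite s_lt // ltnNge leq_eqVlt (negbTE hne) /=; apply/negP => hpq.
  have hnpq : (nth 0 s p == nth 0 s q) = false by rewrite nth_uniq ?uniq_s // (negbTE hne).
  have hX : crossing r1 c1 (nth 0 s p) (nth 0 s q).
    have h1 := topS_cross hrc1' hx.
    rewrite /crossing h1 hx /=; move: vp vq; rewrite h1 /=.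
    case/orP => /eqP ep; rewrite ep hnpq ?eqxx ?orbF //= => /eqP eqq.
    by have := hlg _ _ h1 hx; rewrite ep eqq s_lt //; lia.
  (* Suppose the upper-left pipe [p] has the smaller label. A crossing further left would force [q]
     to climb, one further right would have put [q] above [p], and in the same column [q] has only
     one entrance row. *)
  have [hc1|hc1|hc1] := ltngtP c1 c.
  - have /and4P[h1 _ _ /eqP h4] := hX.
    have hi1 : index (nth 0 s q) (lefts c1.+1) = r1 by rewrite -h4 index_left //; lia.
    have hi2 : index (nth 0 s q) (lefts c.+1) = r by rewrite -hql index_left //; lia.
    have hm : nth 0 s q \in lefts c.+1 by rewrite -hql mem_left //; lia.
    by have := index_lefts_le hm (_ : c1.+1 <= c.+1); rewrite hi1 hi2 => /(_ _); lia.
  - have [_ hinv] := crossing_inverted hpq hq hX.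
    have /andP[h1 h2] := legal_inverted hlg hpq hq hc1 hinv.
    move: h2; rewrite -{1}hql index_left; last by lia.
    have := mem_top hrc; rewrite hpt inE => /orP[/eqP h3|].
      have hcm : c < m by lia.
      by have := uniq_top_lefts hcm; rewrite /= -h3 h1.
    by rewrite in_take //; lia.
  have /and4P[h1 _ _ /eqP h4] := hX.
  have hi1 : index (left r1 c1.+1) (lefts c1.+1) = r1 by apply: index_left; lia.
  have hi2 : index (left r c.+1) (lefts c.+1) = r by apply: index_left; lia.
  by move: hr1; rewrite -hi1 -hi2 h4 hql hc1 ltnn.
(* Conversely, the larger label enters the column above row [r], hence inverted with the smaller
   one, so the two pipes have crossed further right. *)
have [kq hq eq] := top_s hrc.
have /mem_s [kp hp ep] : left r c.+1 \in lefts c.+1 by apply: mem_left; lia.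
have := hlt; rewrite eq ep s_lt // => hpq.
have hi : index (nth 0 s kp) (lefts c.+1) = r by rewrite -ep index_left //; lia.
have hm : nth 0 s kp \in lefts c.+1 by rewrite -ep mem_left //; lia.
have hcp : c < kp by rewrite -(mem_lefts _ hp).
have hm' : nth 0 s kq \in lefts c.+1 by rewrite mem_lefts //; lia.
have hlt' : index (nth 0 s kq) (lefts c.+1) < r.
  have := mem_top hrc; rewrite eq inE => /orP[|]; last by rewrite in_take.
  have hcm : c < m by lia.
  by rewrite nth_uniq ?uniq_s // => /eqP; lia.
have hinv : inverted c.+1 (nth 0 s kp) (nth 0 s kq) by rewrite /inverted hm hi.
have [r' [c' [hc' hx]]] := inverted_crossing hpq hq hinv.
have [_ vq] := crossing_sym_visit hp hq (or_introl (conj erefl hx)).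
have [_ vp] := crossing_sym_visit hq hp (or_intror (conj erefl hx)).
exists kq, kp; rewrite !mem_pipe_visits // /vis hrc hrc1 htc eq ep !eqxx; split=> //.
exists r', c'; have /and4P[h1 h2 _ /eqP h4] := hx.
split=> //; last by lia.
have hm2 : nth 0 s kq \in lefts c'.+1 by rewrite -h4 mem_left //; lia.
have := index_lefts_le hm2 (_ : c.+1 <= c'.+1).
have -> : index (nth 0 s kq) (lefts c'.+1) = r' by rewrite -h4 index_left //; lia.
by move/(_ _); lia.
Qed.

End Trace.

(** * Marked reduced pipe dreams as sequences of columns *)

Lemma sorted_sort_leq (v : seq nat) : uniq v -> sorted ltn (sort leq v).
Proof. by move=> h; rewrite ltn_sorted_uniq_leq sort_uniq h sort_sorted //; exact: leq_total. Qed.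

(** This replaces traced pipes by local conditions on labels, under which columns can be edited one
    at a time. *)
Lemma MRPDP v P : uniq v ->
  MRPD v P <-> [/\ well_shaped (size v) P, okrun (cols (size v) P) (sort leq v) &
                  run (cols (size v) P) (sort leq v) = v].
Proof.
move=> hu; have hs := sorted_sort_leq hu.
rewrite /MRPD /reduced /label -(size_sort leq v); set s := sort leq v in hs *.
have sv : size v = size s by rewrite size_sort.
split=> [[hw hanti [hexit hcross] hmark]|[hw hok hrun]].
  have hP : size P = size s by case: hw.
  have hleg := ncross_le1_legal hs hP hanti hcross.
  have hb r c : tile_at P r c = MBump -> ~~ is_cross (tile_at P r c) by move=> ->.
  split=> //.
    apply/okrun_legal => r c hrc; case: ifP => hrc1.
      case ht: (tile_at P r c) => //=; first by apply: hleg => //; rewrite ht.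
      by have /(markableP hs hP hanti hleg hrc (hb _ _ ht))[] := hmark _ _ hrc ht.
    case ht: (tile_at P r c) => //.
      have : is_bumping (tile_at P r c) by apply: hanti; lia.
      by rewrite ht.
    by have /(markableP hs hP hanti hleg hrc (hb _ _ ht))[] := hmark _ _ hrc ht; rewrite hrc1.
  rewrite -lefts0; apply: (@eq_from_nth _ 0) => [|r]; rewrite size_lefts subn0 ?sv // => hr.
  have hr0 : r + 0 < size s by rewrite addn0.
  (* The label in row [r] of the left boundary belongs to some pipe [k]; since the labels are
     distinct, [r] is the row in which this pipe exits. *)
  have [k hk e] := mem_s (mem_left P hr0).
  rewrite -/(left P s r 0) e -hexit //.
  have [h1 h2] := pipe_exitP hs hP hanti hk.
  have hx0 : pipe_exit P k + 0 < size s by rewrite addn0.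
  by rewrite -(index_left P hs hr0) e -h2 index_left.
have hP : size P = size s by case: hw.
have /okrun_legal h := hok.
have hanti r c : r + c = (size s).-1 -> r < size s -> is_bumping (tile_at P r c).
  move=> h1 h2; have := h r c; case: ifP => [|_ ->] //; lia.
have hleg : legal P s.
  move=> r c hrc ht; have := h r c; rewrite hrc; move: ht.
  by case: (tile_at P r c) => // _; apply; lia.
split=> //; first split.
- move=> k hk; have [h1 h2] := pipe_exitP hs hP hanti hk.
  by rewrite -h2 /left lefts0 hrun.
- by move=> k l; apply: ncross_legal.
move=> r c hrc ht; apply/(markableP hs hP hanti hleg hrc); first by rewrite ht.
by have := h r c hrc; rewrite ht; case: ifP.
Qed.

(** * Removable pipes *)

Lemma top_index P s r c : sorted ltn s -> r + c < size s ->
  r <= index (top P s r c) (lefts P s c) /\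
  (top P s r c \in lefts P s c.+1 -> index (top P s r c) (lefts P s c.+1) < r).
Proof.
move=> hs hrc; have hc : c < size s by lia.
have h1 : r <= size (lefts P s c.+1) by rewrite size_lefts; lia.
have h2 : size (lefts P s c.+1) < size (colT (size s) P c) by rewrite size_lefts size_colT; lia.
have hp := perm_carry (nth 0 s c) h1 h2; rewrite -leftsE // in hp.
have hu := uniq_top_lefts P hs hc.
split=> [|h].
  apply: leq_index_notin; first by rewrite size_lefts; lia.
  have : uniq (nth 0 s c :: take r (lefts P s c.+1)).
    have -> : nth 0 s c :: take r (lefts P s c.+1) = take r.+1 (nth 0 s c :: lefts P s c.+1) by [].
    exact: take_uniq.
  by rewrite -(perm_uniq hp) => /andP[].
have := mem_top P hrc; rewrite inE in_take // => /orP[/eqP e|//].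
by move: hu; rewrite /= -e h.
Qed.

Section Removal.

Variables (v : seq nat) (P : pdream) (C : nat).
Local Notation s := (sort leq v).
Local Notation m := (size v).
Local Notation j := (nth 0 s C).
Hypotheses (uniq_v : uniq v) (hP : MRPD v P) (hC : C < size s).

Let hs : sorted ltn s. Proof. exact: sorted_sort_leq. Qed.
Let size_s : size s = m. Proof. exact: size_sort. Qed.
Let shP : size P = size s. Proof. by rewrite size_s; case: hP => [[]]. Qed.
Let anti r c : r + c = (size s).-1 -> r < size s -> is_bumping (tile_at P r c).
Proof. by rewrite size_s; case: hP => _ h _ _; apply: h. Qed.
Let hok : okrun (cols (size s) P) s.
Proof. by rewrite size_s; case/(MRPDP _ uniq_v): hP. Qed.
(** The row in which pipe [j] enters column [c] from the right, for [c < C]. *)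
Local Notation row c := (index j (lefts P s c.+1)).

Lemma row_bound c : c < C -> (row c).+1 + c < size s.
Proof.
move=> hc; have : row c < size (lefts P s c.+1) by rewrite index_mem mem_lefts.
by rewrite size_lefts; lia.
Qed.

Lemma left_row c : c < C -> left P s (row c) c.+1 = j.
Proof. by move=> hc; rewrite /left nth_index // mem_lefts. Qed.

Lemma vis_okc c r kd : c < C -> okc (colT (size s) P c) (row c) -> vis P s j r c kd ->
  if is_cross (tile_at P (row c) c) then r = row c /\ kd = Horiz
  else [/\ tile_at P (row c) c = Bump, tile_at P (row c).+1 c = Bump &
       (r = row c /\ kd = LR) \/ (r = (row c).+1 /\ kd = UL)].
Proof.
move=> hc hokc hv; have hb := row_bound hc; have hl := left_row hc.
have hrow : row c + c < size s by lia.
have hm : j \in lefts P s c.+1 by rewrite mem_lefts.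
have hcross : is_cross (tile_at P (row c) c) = (nth Cross (colT (size s) P c) (row c) == Cross).
  by rewrite nth_colT.
have hside : (kd == Horiz) || (kd == LR) -> r = row c.
  case: kd hv => //= /and3P[h1 h2 /eqP h3] _; rewrite -h3 index_left //; lia.
have hdown : (kd == Vert) || (kd == UL) -> [/\ r + c < size s, top P s r c = j,
    row c < r & r <= index j (lefts P s c)].
  case: kd hv {hside} => //= /and3P[h1 h2 /eqP h3] _; have [h4 h5] := top_index P hs h1;
    by rewrite h3 in h4 h5; split=> //; apply: h5.
case ht: (is_cross (tile_at P (row c) c)).
  have hex : index j (lefts P s c) = row c.
    by have := index_left P hs hrow; rewrite leftE // ht hl.
  case: kd hv hside hdown => hv hside hdown; try by case: (hdown isT) => _ _; lia.
    by split; first exact: hside.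
  by move: hv (hside isT) => /and3P[_ h _] e; rewrite e ht in h.
move: hokc; rewrite /okc -hcross ht !nth_colT // => /andP[/eqP h1 /eqP h2].
split=> //.
have hex : index j (lefts P s c) = (row c).+1.
  by have := index_left P hs hb; rewrite leftE // h2 topS // ht hl.
case: kd hv hside hdown => hv hside hdown.
- have [h3 h4 h5 h6] := hdown isT.
  have er : r = (row c).+1 by lia.
  by move: hv; rewrite er /vis h2 andbF.
- by move: hv (hside isT) => /and3P[_ h _] e; rewrite e ht in h.
- by right; have [h3 h4 h5 h6] := hdown isT; split=> //; lia.
by left; split; first exact: hside.
Qed.

Lemma remv_cols : remv j (cols (size s) P) s <->
  crosses_bumps (colT (size s) P C) /\
  (forall c, c < C -> okc (colT (size s) P c) (row c)).
Proof.
have key n : forall c, c + n = C ->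
    remv j [seq colT (size s) P c' | c' <- iota c (size s - c)] (drop c s) <->
    crosses_bumps (colT (size s) P C) /\
    (forall c', c <= c' -> c' < C -> okc (colT (size s) P c') (row c')).
  elim: n => [|n IH] c hc; (have hcs : c < size s by lia);
    (have -> : size s - c = (size s - c.+1).+1 by lia); rewrite (drop_nth 0) //=.
    have -> : c = C by lia.
    by rewrite eqxx; split=> [h|[]//]; split=> // c'; lia.
  have -> : (nth 0 s c == j) = false by rewrite nth_uniq ?(uniq_s hs) //; lia.
  rewrite -/(lefts P s c.+1); have hcS : c.+1 + n = C by lia.
  have [IH1 IH2] := IH _ hcS; split=> [/andP[h1 /IH1[h2 h3]]|[h1 h2]].
    split=> // c'; rewrite leq_eqVlt => /orP[/eqP<-//|]; exact: h3.
  apply/andP; split; first by apply: h2; lia.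
  by apply: IH2; split=> // c' h3; apply: h2; lia.
have := key C 0 (add0n _); rewrite subn0 drop0 => -[h1 h2].
split=> [/h1[h3 h4]|[h3 h4]]; first by split=> // c; apply: h4.
by apply: h2; split=> // c _; apply: h4.
Qed.

Let col_ofE : col_of v j = C.
Proof. by rewrite /col_of index_uniq // (uniq_s hs). Qed.

Let mem_visits r c kd : ((r, c, kd) \in pipe_visits P C) = vis P s j r c kd.
Proof. exact: mem_pipe_visits. Qed.

Let last_bump : tile_at P (size s - C.+1) C = Bump.
Proof.
have /okrun_legal /(_ (size s - C.+1) C) h := hok.
by move: h; case: ifP => [|_]; [lia|apply; lia].
Qed.

(** As the last tile is a bump, the number [t] of crossings is smaller than the length of the
    column. The pipe goes straight down through these crossings, so it does visit them. *)
Lemma entrance_column :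
  has (fun t => all (fun r => if r < t
                              then is_cross (tile_at P r C) && visits_cell P C r C
                              else tile_at P r C == Bump)
                    (iota 0 (m - C)))
      (iota 0 (m - C).+1) = crosses_bumps (colT (size s) P C).
Proof.
rewrite -size_s; apply/hasP/crosses_bumpsP => [[t ht /allP h]|[t]].
  have {}h r : r < size s - C -> if r < t then is_cross (tile_at P r C) && visits_cell P C r C
                              else tile_at P r C == Bump.
    by move=> hr; apply: h; rewrite mem_iota.
  have htC : t < size s - C.
    rewrite ltnNge; apply/negP => hlt.
    have := h (size s - C.+1); rewrite last_bump ifT; last by lia.
    by move=> h'; have : false by apply: h'; lia.
  exists t; rewrite ?size_colT //; rewrite -(size_colT P s C).
  apply: eq_crosses_bumps; rewrite size_colT; first exact: ltnW.
  move=> r hr; rewrite nth_colT; last by lia.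
  by have := h r hr; case: ifP => _; [case/andP=> /eqP|move/eqP].
rewrite size_colT => ht e; exists t; first by rewrite mem_iota; lia.
have ht' r : r < size s - C -> tile_at P r C = if r < t then Cross else Bump.
  move=> hr; rewrite -(@nth_colT P s); last by lia.
  rewrite e nth_crosses_bumps; congr (if _ then _ else _).
  have -> : (t + (size s - C - t) <= r) = false by lia.
  by rewrite orbF.
have htop r : r <= t -> top P s r C = j.
  elim: r => [|r IH] hr; first exact: top0.
  by rewrite topS ?ht' ?hr ?IH //; lia.
apply/allP => r; rewrite mem_iota => hr; rewrite ht'; last by lia.
case: (ltnP r t) => hrt //=.
rewrite (visits_cellP hs shP anti) // /at_cell htop; last exact: ltnW.
by rewrite eqxx /= andbT; lia.
Qed.

(** Where pipe [j] enters a column through a crossing, condition (ii) is the test on the tile above.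
    Where it enters through a bump, (iii) makes this bump unmarked and the next tile either a
    crossing or an unmarked bump. *)
Lemma removableE : removable v P j = remv j (cols (size s) P) s.
Proof.
have hj : j \in v by rewrite -(mem_sort leq) mem_nth.
rewrite /removable hj col_ofE entrance_column /=.
apply/idP/idP => [/and3P[hcb /allP h2 /allP h3]|/remv_cols[hcb hcol]].
  apply/remv_cols; split=> // c hc; have hb := row_bound hc; have hl := left_row hc.
  have hrow : row c + c < size s by lia.
  have hrow1 : (row c).-1 + c < size s by lia.
  rewrite /okc !nth_colT //; case: ifP => ht.
    have hv : (row c, c, Horiz) \in pipe_visits P C.
      by rewrite mem_visits /vis hb /is_cross ht hl eqxx.
    by have := h2 _ hv; rewrite /=; case: (row c).
  have hv : (row c, c, LR) \in pipe_visits P C.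
    by rewrite mem_visits /vis hb /is_cross ht hl eqxx.
  have htb : tile_at P (row c) c = Bump.
    by have := h3 _ hv; move: ht; rewrite /=; case: (tile_at _ _ _).
  rewrite htb /=.
  have htop : top P s (row c).+1 c = j by rewrite topS // htb.
  (* A crossing here would be traversed vertically right below an unmarked bump, against condition
     (ii). *)
  case ht' : (is_cross (tile_at P (row c).+1 c)).
    have hv' : ((row c).+1, c, Vert) \in pipe_visits P C.
      by rewrite mem_visits /vis hb ht' htop eqxx.
    by have := h2 _ hv'; rewrite /= htb.
  have hv' : ((row c).+1, c, UL) \in pipe_visits P C.
    by rewrite mem_visits /vis hb ht' htop eqxx.
  by have := h3 _ hv'; move: ht'; rewrite /=; case: (tile_at _ _ _).
have hcC r c kd : vis P s j r c kd -> c <= C.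
  have hcs : r + c < size s -> top P s r c = j -> c <= C.
    move=> h1 h2; have hcs : c < size s by lia.
    have := mem_top P h1; rewrite h2 inE nth_uniq ?(uniq_s hs) //.
    by case/orP => [/eqP->//|/mem_take]; rewrite mem_lefts //; apply: ltnW.
  have hcs' : r.+1 + c < size s -> left P s r c.+1 = j -> c <= C.
    by move=> h1 h2; apply: ltnW; rewrite -(mem_lefts P hs _ hC) -h2 mem_left //; lia.
  by case: kd => /and3P[h1 _ /eqP h2]; by [apply: hcs|apply: hcs'].
have [t ht e] := crosses_bumpsP _ hcb.
rewrite size_colT in ht e.
have ht' r : r + C < size s -> tile_at P r C = if r < t then Cross else Bump.
  move=> hr; rewrite -(@nth_colT P s) // e nth_crosses_bumps; congr (if _ then _ else _).
  have -> : (t + (size s - C - t) <= r) = false by lia.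
  by rewrite orbF.
rewrite hcb /=; apply/andP; split; apply/allP => -[[r c] kd] /=; rewrite mem_visits => hv.
  apply/implyP => hkd; apply/implyP => hr0.
  have := hcC _ _ _ hv; rewrite leq_eqVlt => /orP[/eqP ec|hc].
    have hcr : is_cross (tile_at P r c) /\ r + c < size s.
      by case: kd hkd hv => // _ /and3P[h1 h2 _]; split=> //; lia.
    case: hcr; rewrite ec => h1 h2; move: h1; rewrite !ht' //; last by lia.
    by case: (ltnP r t) => // hrt _; have -> : r.-1 < t by lia.
  have := vis_okc hc (hcol _ hc) hv; case: ifP => hx.
    case=> er _; have := hcol _ hc; have hb := row_bound hc.
    rewrite /okc !nth_colT //; [|lia|lia].
    by rewrite -er in hx *; rewrite (eqP hx) /=; case: (r) hr0.
  by case=> _ _ [[_ ek]|[_ ek]]; rewrite ek in hkd.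
have := hcC _ _ _ hv; rewrite leq_eqVlt => /orP[/eqP ec|hc].
  have hrs : r + c < size s by case: kd hv => /and3P[] *; lia.
  by rewrite ec ht' -?ec //; case: ifP.
have := vis_okc hc (hcol _ hc) hv; case: ifP => hx.
  by case=> er _; rewrite er; move: hx; case: (tile_at _ _ _).
by case=> h1 h2 [[er _]|[er _]]; rewrite er ?h1 ?h2.
Qed.

(** Every visit to column [c] is the claimed one or precedes it in the order [along], which is also
    the order of the trace; so the claimed one comes last. *)
Lemma colexit_removable c : removable v P j -> c < C ->
  colexit P C c = Some (oute (colT (size s) P c) (row c),
                        if is_cross (tile_at P (row c) c) then Horiz else UL).
Proof.
rewrite removableE => /remv_cols[_ hcol] hc; have hb := row_bound hc.
have hrow : row c + c < size s by lia.
set y := (oute (colT (size s) P c) (row c), c, if is_cross (tile_at P (row c) c) then Horiz else UL).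
have hvis r kd : vis P s j r c kd -> (r, c, kd) = y \/ along (r, c, kd) y.
  move=> hv; have := vis_okc hc (hcol _ hc) hv; rewrite /y /oute nth_colT // -/(is_cross _).
  case: ifP => _; first by case=> -> ->; left.
  case=> _ _ [[-> ->]|[-> ->]]; [right|by left].
  by rewrite /along /=; lia.
have hy : y \in pipe_visits P C.
  have hl := left_row hc; have := hcol _ hc.
  rewrite mem_visits /oute /okc !nth_colT //; last by lia.
  rewrite -/(is_cross _); case: ifP => ht; first by rewrite /vis hb ht hl eqxx.
  case/andP => /eqP h1 /eqP h2.
  by rewrite /vis hb h2 topS // h1 hl eqxx.
have hyf : y \in [seq x <- pipe_visits P C | x.1.2 == c] by rewrite mem_filter eqxx.
have hpw : pairwise along [seq x <- pipe_visits P C | x.1.2 == c].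
  apply: subseq_pairwise (filter_subseq _ _) _.
  exact: (pairwise_pipe_visits hs shP anti).
rewrite /colexit; move: hyf hpw; have : forall x, x \in [seq x <- pipe_visits P C | x.1.2 == c] ->
    x = y \/ along x y.
  by case=> [[r c'] kd]; rewrite mem_filter /= => /andP[/eqP->]; rewrite mem_visits; apply: hvis.
case/lastP: [seq _ <- _ | _] => [|t z] // h; rewrite mem_rcons inE rev_rcons /=.
case/orP => [/eqP <- //|hyt]; rewrite pairwise_rcons => /andP[/allP /(_ _ hyt) hyz _].
have [->//|hzy] : z = y \/ along z y by apply: h; rewrite mem_rcons mem_head.
by move: hyz hzy; rewrite /along; lia.
Qed.

Lemma size_PhiOne : size (PhiOne v P j).2 = m.-1.
Proof. by rewrite size_mkseq. Qed.

Lemma well_shaped_PhiOne : well_shaped m.-1 (PhiOne v P j).2.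
Proof.
split=> [|r hr]; first exact: size_PhiOne.
by rewrite /= nth_mkseq // size_mkseq.
Qed.

Lemma tile_at_PhiOne r c : r + c < m.-1 -> tile_at (PhiOne v P j).2 r c = newtile P C r c.
Proof.
move=> h; rewrite /tile_at /= nth_mkseq; last by lia.
by rewrite nth_mkseq ?col_ofE //; lia.
Qed.

Lemma colT_PhiOne_lt c : removable v P j -> c < C ->
  colT (size s).-1 (PhiOne v P j).2 c = delat (row c) (colT (size s) P c).
Proof.
move=> hr hc; have hb := row_bound hc.
have hcol : okc (colT (size s) P c) (row c).
  by move: hr; rewrite removableE => /remv_cols[_]; apply.
apply: (@eq_from_nth _ Cross) => [|r].
  by rewrite size_delat !size_mkseq; lia.
rewrite size_mkseq => hrc.
have hrow : row c + c < size s by lia.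
have hrow1 : (row c).-1 + c < size s by lia.
have hrc1 : r + c < size s by lia.
have hrc2 : r.+1 + c < size s by lia.
have -> : nth Cross (delat (row c) (colT (size s) P c)) r =
    if r < row c then tile_at P r c else tile_at P r.+1 c.
  by rewrite nth_delat; case: ifP => _; rewrite nth_colT.
rewrite nth_mkseq // tile_at_PhiOne; last by rewrite -size_s; lia.
rewrite /newtile leqNgt hc /= colexit_removable //.
move: hcol; rewrite /okc /oute !nth_colT // -/(is_cross _).
case: ifP => ht; first by move=> _; case: ltnP.
(* With two bumps the exit row is [(row c).+1], so the tests of [newtile] compare [r] with [row c],
   and the merged bump stands in that row. *)
case/andP => /eqP h1 /eqP h2; rewrite ltnS eqSS.
by case: ltngtP => // ->.
Qed.

Lemma cols_PhiOne : removable v P j ->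
  cols (size s).-1 (PhiOne v P j).2 = delrun j (cols (size s) P) s.
Proof.
move=> hr.
have hge c : C <= c -> colT (size s).-1 (PhiOne v P j).2 c = colT (size s) P c.+1.
  move=> hc; rewrite /colT; have -> : (size s).-1 - c = size s - c.+1 by lia.
  apply/eq_in_map => r; rewrite mem_iota => h.
  by rewrite tile_at_PhiOne -?size_s /newtile ?hc //; lia.
have key n : forall c, c + n = C ->
    [seq colT (size s).-1 (PhiOne v P j).2 c' | c' <- iota c ((size s).-1 - c)] =
    delrun j [seq colT (size s) P c' | c' <- iota c (size s - c)] (drop c s).
  elim: n => [|n IH] c hc; (have hcs : c < size s by lia);
    (have -> : size s - c = (size s - c.+1).+1 by lia); rewrite (drop_nth 0) //=.
    have ec : c = C by lia.
    rewrite ec eqxx; have -> : (size s).-1 - C = size s - C.+1 by lia.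
    rewrite [in RHS](iotaDl 1 C) -map_comp; apply/eq_in_map => c'; rewrite mem_iota => h /=.
    by rewrite hge //; lia.
  have -> : (nth 0 s c == j) = false by rewrite nth_uniq ?(uniq_s hs) //; lia.
  have -> : (size s).-1 - c = ((size s).-1 - c.+1).+1 by lia.
  by rewrite /= IH ?colT_PhiOne_lt //; lia.
by have := key C 0 (add0n _); rewrite !subn0 drop0.
Qed.

End Removal.

(** * The reduction map *)

Lemma sort_rem (j : nat) v : uniq v -> sort leq (rem j v) = rem j (sort leq v).
Proof.
move=> hu; apply: (sorted_eq leq_trans anti_leq).
- exact: sort_sorted leq_total _.
- apply: (subseq_sorted leq_trans (rem_subseq _ _)); exact: sort_sorted leq_total _.
rewrite perm_sort; apply: uniq_perm; rewrite ?rem_uniq ?sort_uniq //.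
by move=> x; rewrite !mem_rem_uniq ?sort_uniq // !inE mem_sort.
Qed.

Lemma cols_inj m P Q : well_shaped m P -> well_shaped m Q -> cols m P = cols m Q -> P = Q.
Proof.
move=> [hP1 hP2] [hQ1 hQ2] /eq_in_map h.
have ht r c : r + c < m -> tile_at P r c = tile_at Q r c.
  move=> hrc; have := h c; rewrite mem_iota => /(_ _) e.
  have /(congr1 (fun T => nth Cross T r)) : colT m P c = colT m Q c by apply: e; lia.
  by rewrite !nth_mkseq //; lia.
apply: (@eq_from_nth _ [::]) => [|r]; rewrite hP1 // => hr.
apply: (@eq_from_nth _ Cross) => [|c]; rewrite hP2 ?hQ2 // => hc.
by apply: ht; lia.
Qed.

Lemma cols_surj cs s : okrun cs s ->
  exists P, well_shaped (size s) P /\ cols (size s) P = cs.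
Proof.
move=> hok; have hs := okrun_size hok.
have hsc c : c < size s -> size (nth [::] cs c) = size s - c.
  elim: cs s c hok {hs} => [|T cs IH] [|a s] [|c] //= /andP[h1 h2] hc.
    by rewrite (size_okcol h1) (perm_size (okrun_perm h2)).
  by rewrite (IH s c) // subSS.
exists (mkseq (fun r => mkseq (fun c => nth Cross (nth [::] cs c) r) (size s - r)) (size s)).
split; first by split=> [|r hr]; rewrite ?size_mkseq // nth_mkseq // size_mkseq.
apply: (@eq_from_nth _ [::]) => [|c]; rewrite size_map size_iota ?hs // => hc.
rewrite (nth_map 0) ?size_iota // nth_iota // add0n.
apply: (@eq_from_nth _ Cross) => [|r]; rewrite size_mkseq ?hsc // => hr.
by rewrite nth_mkseq // /tile_at nth_mkseq ?nth_mkseq //; lia.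
Qed.

Lemma removable_mem v P j : removable v P j -> j \in v.
Proof. by case/and4P. Qed.

Section Entrance.

Variables (v : seq nat) (j : nat).
Hypotheses (uniq_v : uniq v) (hj : j \in v).

Let s := sort leq v.
Let js : j \in s. Proof. by rewrite mem_sort. Qed.

Lemma cols_PhiOne_mem P : MRPD v P -> removable v P j ->
  cols (size (rem j v)) (PhiOne v P j).2 = delrun j (cols (size v) P) s.
Proof.
move=> hP; have hC : index j s < size s by rewrite index_mem.
have := @cols_PhiOne v P (index j s) uniq_v hP hC; rewrite nth_index //.
by rewrite -/s /s size_sort size_rem.
Qed.

Lemma removable_remv P : MRPD v P -> removable v P j = remv j (cols (size v) P) s.
Proof.
move=> hP; have hC : index j s < size s by rewrite index_mem.
by have := @removableE v P (index j s) uniq_v hP hC; rewrite nth_index // size_sort.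
Qed.

Lemma well_shaped_PhiOne_rem P : well_shaped (size (rem j v)) (PhiOne v P j).2.
Proof. by rewrite size_rem //; have := @well_shaped_PhiOne v P (index j s); rewrite nth_index. Qed.

End Entrance.

Lemma MRPD_PhiOne v P j : uniq v -> MRPD v P -> removable v P j ->
  MRPD (rem j v) (PhiOne v P j).2.
Proof.
move=> hu hP hr; have hj := removable_mem hr.
apply/MRPDP; rewrite ?rem_uniq // cols_PhiOne_mem // sort_rem //.
have [hw hok hrun] := (MRPDP P hu).1 hP.
move: hr; rewrite removable_remv // => hr.
have [|h1 h2] := delrun_ok _ hok hr; first by rewrite sort_uniq.
by split; [exact: well_shaped_PhiOne_rem|exact: h1|rewrite h2 hrun].
Qed.

Lemma removable_PhiOne v P j j' : uniq v -> MRPD v P -> removable v P j -> j' != j ->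
  removable (rem j v) (PhiOne v P j).2 j' = removable v P j'.
Proof.
move=> hu hP hr hjj; have hj := removable_mem hr.
have hur : uniq (rem j v) by rewrite rem_uniq.
have hP' := MRPD_PhiOne hu hP hr.
have hmem : (j' \in rem j v) = (j' \in v) by rewrite mem_rem_uniq // !inE hjj.
case hj' : (j' \in v); last first.
  by rewrite /removable hmem hj'.
rewrite !removable_remv ?hmem // cols_PhiOne_mem // sort_rem //.
apply: remv_delrun; rewrite ?sort_uniq // 1?eq_sym //.
  by have [] := (MRPDP P hu).1 hP.
by rewrite -removable_remv.
Qed.

(** Both pipe dreams arise from the common image by inserting [j] from the same exit row, its
    position in [v]. *)
Lemma PhiOne_inj v P Q j : uniq v -> MRPD v P -> MRPD v Q ->
  removable v P j -> removable v Q j -> PhiOne v P j = PhiOne v Q j -> P = Q.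
Proof.
move=> hu hP hQ hrP hrQ e; have hj := removable_mem hrP.
have [hwP hokP hrunP] := (MRPDP P hu).1 hP.
have [hwQ hokQ hrunQ] := (MRPDP Q hu).1 hQ.
apply: (cols_inj hwP hwQ).
have hs := sorted_sort_leq hu.
rewrite removable_remv // in hrP; rewrite removable_remv // in hrQ.
rewrite -(insrun_delrun hs hokP hrP) -(insrun_delrun hs hokQ hrQ) hrunP hrunQ.
by congr insrun; rewrite -!cols_PhiOne_mem ?e // removable_remv.
Qed.

(** The positions that remain are mapped increasingly into those of [w], so a pattern would already
    occur in [w]. *)
Lemma avoids1423_rem (w : seq nat) (j : nat) : avoids1423 w -> avoids1423 (rem j w).
Proof.
rewrite rem_delat => h i1 i2 i3 i4 h12 h23 h34 h4; rewrite !nth_delat.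
pose f i := if i < index j w then i else i.+1.
have hf i i' : i < i' -> f i < f i'.
  by rewrite /f => hii; case: (ltnP i (index j w)); case: (ltnP i' (index j w)); lia.
apply: (h (f i1) (f i2) (f i3) (f i4)); try exact: hf.
rewrite /f; have [hj|hj] := boolP (j \in w).
  by rewrite size_delat ?index_mem // in h4; case: ifP; lia.
have hl : index j w = size w by apply/eqP; rewrite eqn_leq index_size leqNgt index_mem.
rewrite /delat hl take_size drop_oversize ?cats0 // in h4.
by rewrite hl h4.
Qed.

Lemma avoids1423_pattern (w : seq nat) (j : nat) : avoids1423 w -> j \in w ->
  ~ pattern j (take (index j w) w) (drop (index j w).+1 w).
Proof.
move=> hav hj [d [b [/andP[hd /hasP[x hx hxj]] hb hjb hbd]]].
set e := index j w in hd hx hb *.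
have he : e < size w by rewrite index_mem.
have hq : index d (take e w) < e by move: hd; rewrite -index_mem size_take he.
have [p hp1 hp2] := nthP 0 hx.
have [r hr1 hr2] := nthP 0 hb.
have hpq : p < index d (take e w).
  by move: hp1; rewrite size_take; case: ifP => // h; rewrite size_take he in h *; lia.
rewrite size_drop in hr1.
apply: (hav p (index d (take e w)) e (e.+1 + r)) => //; first by rewrite addSn ltnS leq_addr.
  by rewrite -ltn_subRL.
rewrite [nth 0 w e]nth_index // -nth_drop hr2.
have -> : nth 0 w (index d (take e w)) = d.
  by rewrite -(nth_take 0 hq) nth_index.
have -> : nth 0 w p = x.
  by rewrite -hp2 nth_take // nth_take //; lia.
by [].
Qed.

(** Pipe [j] is inserted from row [index j w]. Avoidance of 1423 says that the labels above and
    below this row form no [pattern], which makes every inserted crossing legal. *)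
Lemma PhiOne_surj (w : seq nat) (j : nat) Q : uniq w -> avoids1423 w -> j \in w -> MRPD (rem j w) Q ->
  exists P, [/\ MRPD w P, removable w P j & PhiOne w P j = (rem j w, Q)].
Proof.
move=> hu hav hj hQ.
have hur : uniq (rem j w) by rewrite rem_uniq.
have [hwQ hokQ hrunQ] := (MRPDP Q hur).1 hQ.
have hs := sorted_sort_leq hu.
rewrite sort_rem // in hokQ hrunQ.
have hjs : j \in sort leq w by rewrite mem_sort.
have he : index j w <= size (cols (size (rem j w)) Q).
  rewrite size_map size_iota size_rem //.
  have : index j w < size w by rewrite index_mem.
  by case: (size w).
have [|h1 h2 h3 h4] := insrun_ok hs hjs he hokQ.
  rewrite hrunQ rem_delat /delat.
  have hsz : size (take (index j w) w) = index j w by rewrite size_takel // index_size.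
  rewrite take_size_cat // drop_size_cat //.
  exact: avoids1423_pattern.
have [P []] := cols_surj h1; rewrite size_sort => hwP hcP.
rewrite -hcP hrunQ insat_rem // in h1 h2 h3 h4.
have hP : MRPD w P by apply/MRPDP.
have hr : removable w P j by rewrite removable_remv.
exists P; split=> //.
rewrite [PhiOne _ _ _]surjective_pairing; congr pair.
apply: (cols_inj (well_shaped_PhiOne_rem hj P) hwQ).
by rewrite cols_PhiOne_mem.
Qed.

(** [Phi] with an arbitrary list of pipes to remove. The list in [Phi] depends on the pipe dream;
    fixing it allows induction. *)
Definition PhiSeq (w : seq nat) (P : pdream) (js : seq nat) : seq nat * pdream :=
  foldl (fun acc j => PhiOne acc.1 acc.2 j) (w, P) js.

Lemma PhiSeq_cons w P j js :
  PhiSeq w P (j :: js) = PhiSeq (rem j w) (PhiOne w P j).2 js.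
Proof. by []. Qed.

Lemma filter_rem j js (w : seq nat) : uniq w ->
  [seq x <- rem j w | x \notin js] = [seq x <- w | x \notin j :: js].
Proof.
move=> hu; rewrite rem_filter // -filter_predI; apply: eq_filter => x.
by rewrite /= inE negb_or andbC.
Qed.

(** Removing one pipe does not change whether another is removable. So once all removable pipes are
    gone, the result is core. *)
Lemma PhiSeq_removable w P js : uniq w -> uniq js -> MRPD w P ->
  (forall j, j \in js -> removable w P j) ->
  [/\ (PhiSeq w P js).1 = [seq x <- w | x \notin js],
      MRPD (PhiSeq w P js).1 (PhiSeq w P js).2 &
      forall j, j \notin js -> removable (PhiSeq w P js).1 (PhiSeq w P js).2 j = removable w P j].
Proof.
elim: js w P => [|j js IH] w P hu /=.
  by move=> _ hP _; split=> //; rewrite filter_predT.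
case/andP => hj hjs hP hr; rewrite PhiSeq_cons.
have hrj : removable w P j by apply: hr; rewrite mem_head.
have hP' := MRPD_PhiOne hu hP hrj.
have [||h1 h2 h3] := IH (rem j w) (PhiOne w P j).2 _ hjs hP'.
- by rewrite rem_uniq.
- move=> j' hj'; rewrite removable_PhiOne //; last by apply: contraNneq hj => <-.
  by apply: hr; rewrite inE hj' orbT.
split=> //; first by rewrite h1 filter_rem.
move=> j'; rewrite inE negb_or => /andP[h4 h5].
by rewrite h3 // removable_PhiOne.
Qed.

Lemma PhiSeq_inj w P Q js : uniq w -> uniq js -> MRPD w P -> MRPD w Q ->
  (forall j, j \in js -> removable w P j) -> (forall j, j \in js -> removable w Q j) ->
  PhiSeq w P js = PhiSeq w Q js -> P = Q.
Proof.
elim: js w P Q => [|j js IH] w P Q hu /=; first by move=> _ _ _ _ _ [].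
case/andP => hj hjs hP hQ hrP hrQ; rewrite !PhiSeq_cons => e.
have hrPj : removable w P j by apply: hrP; rewrite mem_head.
have hrQj : removable w Q j by apply: hrQ; rewrite mem_head.
have hur : uniq (rem j w) by rewrite rem_uniq.
apply: (PhiOne_inj hu hP hQ hrPj hrQj).
rewrite [LHS]surjective_pairing [RHS]surjective_pairing; congr pair.
apply: IH e => //; try exact: MRPD_PhiOne.
  move=> j' hj'; rewrite removable_PhiOne //; last by apply: contraNneq hj => <-.
  by apply: hrP; rewrite inE hj' orbT.
move=> j' hj'; rewrite removable_PhiOne //; last by apply: contraNneq hj => <-.
by apply: hrQ; rewrite inE hj' orbT.
Qed.

(** The pipes in [js] are inserted one by one, the last first. Each insertion makes just the new
    pipe removable, and [Q] is core, so the removable pipes at the end are exactly those in [js]. *)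
Lemma PhiSeq_surj (w js : seq nat) Q : uniq w -> avoids1423 w -> uniq js -> {subset js <= w} ->
  CMRPD [seq x <- w | x \notin js] Q ->
  exists P, [/\ MRPD w P, (forall j, removable w P j = (j \in js)) &
                PhiSeq w P js = ([seq x <- w | x \notin js], Q)].
Proof.
elim: js w => [|j js IH] w hu hav /=.
  move=> _ _; rewrite filter_predT => -[hQ hc]; exists Q; split=> // j.
  exact/negbTE/hc.
case/andP => hj hjs hsub; rewrite -filter_rem // => hQ.
have hjw : j \in w by apply: hsub; rewrite mem_head.
have hur : uniq (rem j w) by rewrite rem_uniq.
have [|P' [hP' hr' e']] := IH (rem j w) hur (avoids1423_rem (j := j) hav) hjs _ hQ.
  move=> x hx; rewrite mem_rem_uniq // !inE hsub ?inE ?hx ?orbT // andbT.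
  by apply: contraNneq hj => <-.
have [P [hP hr e]] := PhiOne_surj hu hav hjw hP'.
exists P; split=> //; last by rewrite PhiSeq_cons e.
move=> x; rewrite inE; have [->|hx] := eqVneq x j; first by rewrite hr.
by rewrite -(removable_PhiOne hu hP hr hx) e hr'.
Qed.

Theorem theorem3p8 (n : nat) (w : seq nat) :
  perm_eq w (iota 1 n) -> avoids1423 w ->
  (forall P, MRPD w P ->
     subseq (Phi w P).1 w /\ CMRPD (Phi w P).1 (Phi w P).2) /\
  (forall (v : seq nat) (Q : pdream), subseq v w -> CMRPD v Q ->
     exists! P, MRPD w P /\ Phi w P = (v, Q)).
Proof.
move=> hw hav; have hu : uniq w by rewrite (perm_uniq hw) iota_uniq.
have hPhi P : Phi w P = PhiSeq w P [seq j <- w | removable w P j] by [].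
have hrem P j : j \in [seq j <- w | removable w P j] -> removable w P j.
  by rewrite mem_filter => /andP[].
split=> [P hP|v Q hv hQ].
  have [h1 h2 h3] := PhiSeq_removable hu (filter_uniq _ hu) hP (hrem P).
  rewrite hPhi {1}h1; split; first exact: filter_subseq.
  split=> // j; have [hj|hj] := boolP (j \in [seq j <- w | removable w P j]).
    by apply/negP => /removable_mem; rewrite h1 mem_filter hj.
  rewrite h3 //; apply: contra hj => hj; rewrite mem_filter hj.
  exact: removable_mem hj.
(* The labels missing from [v] are the pipes that have to be inserted. *)
pose js := [seq j <- w | j \notin v].
have /(subseq_uniqP hu) ev := hv.
have hjs : [seq x <- w | x \notin js] = v.
  rewrite [RHS]ev; apply: eq_in_filter => x hx.
  by rewrite mem_filter hx andbT negbK.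
(* Every preimage has the same removable pipes, since the word component of [Phi] is [w] without
   them. Uniqueness thus reduces to a fixed list [js]. *)
have hjsv P R : MRPD w P -> Phi w P = (v, R) -> [seq j <- w | removable w P j] = js.
  move=> hP; rewrite hPhi => e.
  have [h1 _ _] := PhiSeq_removable hu (filter_uniq _ hu) hP (hrem P).
  apply: eq_in_filter => x hx; rewrite e /= in h1.
  by rewrite h1 !mem_filter hx !andbT negbK.
rewrite -hjs in hQ.
have [|P [hP hr e]] := PhiSeq_surj hu hav (filter_uniq _ hu) _ hQ.
  by move=> x; rewrite mem_filter => /andP[].
have ePhi : Phi w P = (v, Q).
  rewrite hPhi -hjs -e; congr PhiSeq; apply: eq_in_filter => x hx.
  by rewrite hr mem_filter hx andbT.
exists P; split=> // P2 [hP2 e2].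
apply: (@PhiSeq_inj w P P2 js) => //.
- exact: filter_uniq.
- by move=> j hj; rewrite hr.
- by move=> j; rewrite -(hjsv _ _ hP2 e2); apply: hrem.
by rewrite e hjs -e2 hPhi (hjsv _ _ hP2 e2).
Qed.
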